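(* Let $N\geq 3$ and let $F\in GL_N(\mathbb C)$ satisfy $F\overline F=\varepsilon I_N$ for some $\varepsilon\in\{\pm1\}$ and $F^*F=I_N$. Let $u=u^*\in\operatorname{Pol}(O_F^+)$ satisfy $h(u)=0$. Define $S,Q\geq 0$ by $$S^2=h(u^2),\qquad Q^2=h\bigl(u(L-I)u\bigr).$$ Then $$|h(u^3)|\leq 3S^2Q+Q^3.$$
   Context: Let $N\ge 2$ and $F\in GL_N(\mathbb C)$ with $F\overline F=\pm I_N$ and $F^*F=I_N$ ($\overline F$ is the entrywise complex conjugate). The free orthogonal quantum group $O_F^+$ is the compact quantum group whose $C^*$-algebra $C(O_F^+)$ is the universal unital $C^*$-algebra generated by the entries of a unitary matrix $u^1=(u^1_{ij})_{1\le i,j\le N}$ subject to $u^1=F\,\overline{u^1}\,F^{-1}$, where $\overline{u^1}=((u^1_{ij})^* )$, with coproduct $\Delta(u^1_{ij})=\sum_{k}u^1_{ik}\otimes u^1_{kj}$. Since $F$ is unitary, $O_F^+$ is of Kac type: its Haar state $h$ is a trace. $L_2(O_F^+)$ is the GNS Hilbert space of $h$, with $\|x\|_2=h(x^*x)^{1/2}$. The irreducible unitary representations of $O_F^+$ are, up to equivalence, $u^k=(u^k_{ij})_{1\le i,j\le d_k}$, $k\in\mathbb N_0=\{0,1,2,\dots\}$, with $u^0=\mathbf 1$, $u^1$ the fundamental representation above, and fusion rules $u^i\otimes u^j\simeq u^{|i-j|}\oplus u^{|i-j|+2}\oplus\cdots\oplus u^{i+j}$. $\operatorname{Pol}(O_F^+)$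 is the linear span of all $u^k_{ij}$ (a $*$-algebra). Put $V_k=\operatorname{span}\{u^k_{ij}:1\le i,j\le d_k\}$; then $L_2(O_F^+)=\bigoplus_{k\ge0}V_k$ orthogonally. The monic Chebyshev polynomials of the second kind are $U_0(x)=1$, $U_1(x)=x$, $U_{k+1}(x)=xU_k(x)-U_{k-1}(x)$; one has $d_k=U_k(N)$. Put $\alpha_k=N\,U_k'(N)/U_k(N)$ (so $\alpha_0=0$, $\alpha_1=1$). $L$ is the nonnegative self-adjoint operator on $L_2(O_F^+)$ with $L|_{V_k}=\alpha_k I_{V_k}$; it maps $\operatorname{Pol}(O_F^+)$ to itself. Since $\alpha_k\ge 1$ for all $k\ge1$, $h(u(L-I)u)\ge0$ for self-adjoint $u\in\operatorname{Pol}(O_F^+)$ with $h(u)=0$. The element $u$ in the statement is an arbitrary element of $\operatorname{Pol}(O_F^+)$, not a representation matrix. *)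

(* Defs.v *)
From HB Require Import structures.
From mathcomp Require Import all_boot all_order all_algebra.
From mathcomp Require Import reals.
From mathcomp Require Import complex mxtens.

Set Implicit Arguments.
Unset Strict Implicit.
Unset Printing Implicit Defensive.

Import Order.TTheory GRing.Theory Num.Theory.
Local Open Scope ring_scope.
Local Open Scope complex_scope.

(* Unital C*-algebras.  The norm is a field and not the MathComp-Analysis norm:
   Hierarchy Builder rejects a join of Algebra and CompleteNormedModule declared
   after numDomainType. *)
Record cstarAlg (R : realType) := CStarAlg {
  cstar_sort :> algType R[i];
  star : cstar_sort -> cstar_sort;
  cnorm : cstar_sort -> R;
  starD : forall x y, star (x + y) = star x + star y;
  starZ : forall (c : R[i]) x, star (c *: x) = Num.conj c *: star x;
  starM : forall x y, star (x * y) = star y * star x;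
  starK : forall x, star (star x) = x;
  cnorm_eq0 : forall x, cnorm x = 0 -> x = 0;
  cnormD : forall x y, cnorm (x + y) <= cnorm x + cnorm y;
  cnormZ : forall (c : R[i]) x, (cnorm (c *: x))%:C = `|c| * (cnorm x)%:C;
  cnormM : forall x y, cnorm (x * y) <= cnorm x * cnorm y;
  cnorm_star : forall x, cnorm (star x * x) = cnorm x ^+ 2;
  cnorm_complete : forall x : nat -> cstar_sort,
    (forall e : R, 0 < e ->
       exists n0, forall m n, (n0 <= m)%N -> (n0 <= n)%N ->
         cnorm (x m - x n) <= e) ->
    exists l, forall e : R, 0 < e ->
      exists n0, forall n, (n0 <= n)%N -> cnorm (x n - l) <= e
}.

Definition star_preserving (R : realType) (A B : cstarAlg R) (f : A -> B) :=
  forall x, f (star x) = star (f x).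

Section Matrices.
Variables (R : realType) (A : cstarAlg R).

Definition conj_mx m n (v : 'M[A]_(m, n)) : 'M[A]_(m, n) :=
  map_mx (@star R A) v.

Definition adj_mx m n (v : 'M[A]_(m, n)) : 'M[A]_(n, m) := (conj_mx v)^T.

Definition unitary_mx n (v : 'M[A]_n) :=
  v *m adj_mx v = 1%:M /\ adj_mx v *m v = 1%:M.

Definition scal_mx m n (M : 'M[R[i]]_(m, n)) : 'M[A]_(m, n) :=
  map_mx (fun c => c%:A) M.

End Matrices.

Definition conjC_mx (R : realType) m n (M : 'M[R[i]]_(m, n)) :
  'M[R[i]]_(m, n) := map_mx Num.conj M.

Definition adjC_mx (R : realType) m n (M : 'M[R[i]]_(m, n)) :
  'M[R[i]]_(n, m) := (conjC_mx M)^T.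

Definition OF_relations (R : realType) N (F : 'M[R[i]]_N)
    (B : cstarAlg R) (v : 'M[B]_N) :=
  unitary_mx v /\ v = scal_mx B F *m conj_mx v *m scal_mx B (invmx F).

Definition universal_OF (R : realType) N (F : 'M[R[i]]_N)
    (A : cstarAlg R) (u1 : 'M[A]_N) :=
  OF_relations F u1 /\
  forall (B : cstarAlg R) (v : 'M[B]_N), OF_relations F v ->
    exists f : {lrmorphism A -> B},
      [/\ star_preserving f, map_mx f u1 = v &
          forall g : {lrmorphism A -> B},
            star_preserving g -> map_mx g u1 = v -> g =1 f].

Section Tensor.
Variables (R : realType) (A B : cstarAlg R).

(* i1 a * i2 b stands for the elementary tensor a (x) b.  The last condition
   says that the algebraic tensor product of A and B embeds in T, that is, T
   induces a C*-norm on it. *)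
Definition cstar_tensor (T : cstarAlg R)
    (i1 : {lrmorphism A -> T}) (i2 : {lrmorphism B -> T}) :=
  [/\ star_preserving i1, star_preserving i2,
      forall a b, i1 a * i2 b = i2 b * i1 a &
      forall n (a : 'I_n -> A) (b : 'I_n -> B),
        (forall c : 'I_n -> R[i], \sum_k c k *: a k = 0 -> forall k, c k = 0) ->
        \sum_k i1 (a k) * i2 (b k) = 0 -> forall k, b k = 0].

(* The minimal (spatial) tensor product: the completion of the algebraic tensor
   product for its smallest C*-norm. *)
Definition min_tensor (T : cstarAlg R)
    (i1 : {lrmorphism A -> T}) (i2 : {lrmorphism B -> T}) :=
  [/\ cstar_tensor i1 i2,
      forall (t : T) (e : R), 0 < e ->
        exists n (a : 'I_n -> A) (b : 'I_n -> B),
          cnorm (t - \sum_k i1 (a k) * i2 (b k)) <= e &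
      forall (T' : cstarAlg R)
             (j1 : {lrmorphism A -> T'}) (j2 : {lrmorphism B -> T'}),
        cstar_tensor j1 j2 ->
        forall n (a : 'I_n -> A) (b : 'I_n -> B),
          cnorm (\sum_k i1 (a k) * i2 (b k))
            <= cnorm (\sum_k j1 (a k) * j2 (b k))].

End Tensor.

Section QuantumGroup.
Variables (R : realType) (A T : cstarAlg R).
Variables (i1 i2 : {lrmorphism A -> T}) (Delta : {lrmorphism A -> T}).

Definition comult_mx n (v : 'M[A]_n) :=
  forall i j, Delta (v i j) = \sum_k i1 (v i k) * i2 (v k j).

Definition free_orthogonal N (F : 'M[R[i]]_N) (u1 : 'M[A]_N) :=
  [/\ universal_OF F u1, min_tensor i1 i2,
      star_preserving Delta & comult_mx u1].

Definition bounded_map (B C : cstarAlg R) (s : B -> C) :=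
  exists K : R, forall x, cnorm (s x) <= K * cnorm x.

(* The maps s below are the slice maps h (x) id and id (x) h. *)
Definition haar_state (h : {scalar A}) :=
  [/\ h 1 = 1,
      forall x, 0 <= h (star x * x),
      exists s : {linear T -> A},
        [/\ bounded_map s, forall a b, s (i1 a * i2 b) = h a *: b &
            forall x, s (Delta x) = (h x)%:A] &
      exists s : {linear T -> A},
        [/\ bounded_map s, forall a b, s (i1 a * i2 b) = h b *: a &
            forall x, s (Delta x) = (h x)%:A]].

Definition unitary_rep n (v : 'M[A]_n) := unitary_mx v /\ comult_mx v.

Definition rep_equiv m n (v : 'M[A]_m) (w : 'M[A]_n) :=
  exists S : 'M[R[i]]_(m, n),
    [/\ S *m adjC_mx S = 1%:M, adjC_mx S *m S = 1%:M &
        v *m scal_mx A S = scal_mx A S *m w].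

(* The range of the idempotent e is a v-invariant subspace of C^n iff
   v e = e v e. *)
Definition irreducible_rep n (v : 'M[A]_n) :=
  (0 < n)%N /\
  forall e : 'M[R[i]]_n, e *m e = e ->
    v *m scal_mx A e = scal_mx A e *m v *m scal_mx A e ->
    e = 0 \/ e = 1%:M.

Definition fusion_sum (d : nat -> nat) (w : forall k, 'M[A]_(d k)) (i j : nat) :=
  mxdiag (fun l : 'I_(minn i j).+1 => w (maxn i j - minn i j + l.*2)%N).

Record irreps N (u1 : 'M[A]_N) (d : nat -> nat) (w : forall k, 'M[A]_(d k)) :
    Prop := Irreps {
  irreps_rep : forall k, unitary_rep (w k);
  irreps_irr : forall k, irreducible_rep (w k);
  irreps_inj : forall k l, rep_equiv (w k) (w l) -> k = l;
  irreps_all : forall n (v : 'M[A]_n),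
    unitary_rep v -> irreducible_rep v -> exists k, rep_equiv v (w k);
  irreps0 : rep_equiv (w 0) (1%:M : 'M[A]_1);
  irreps1 : rep_equiv (w 1) u1;
  irreps_fusion : forall i j, rep_equiv (w i *t w j) (fusion_sum w i j)
}.

Definition coeff_space (d : nat -> nat) (w : forall k, 'M[A]_(d k)) (k : nat)
    (x : A) :=
  exists c : 'M[R[i]]_(d k), x = \sum_i \sum_j c i j *: w k i j.

Definition Pol (d : nat -> nat) (w : forall k, 'M[A]_(d k)) (x : A) :=
  exists n (y : nat -> A),
    (forall k, coeff_space w k (y k)) /\ x = \sum_(k < n) y k.

End QuantumGroup.

Fixpoint chebU (R : realType) (k : nat) : {poly R} :=
  match k with
  | 0 => 1
  | 1 => 'X
  | (k'.+1 as k1).+1 => 'X * chebU R k1 - chebU R k'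
  end.

Definition alpha (R : realType) (N k : nat) : R :=
  N%:R * (chebU R k)^`().[N%:R] / (chebU R k).[N%:R].

(* L is the restriction to Pol of the operator acting on V_k by alpha k; its
   values outside Pol are irrelevant. *)
Definition generator (R : realType) (N : nat) (A : cstarAlg R) (d : nat -> nat)
    (w : forall k, 'M[A]_(d k)) (L : A -> A) :=
  forall n (y : nat -> A), (forall k, coeff_space w k (y k)) ->
    L (\sum_(k < n) y k) = \sum_(k < n) (alpha R N k)%:C *: y k.

(* Main.v *)
(** Write [u] as the sum of its components [u_k] in [V_k], with norms [x_k]; then
    [x_0 = 0], [S^2] is the sum of the [x_k^2] and [Q^2] the sum of the
    [(alpha_k - 1) x_k^2].  By the fusion rules only the triples
    [(i, j, l) = (a + b, a + c, b + c)] contribute to [h(u^3) = h(u^* u u)], and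

      [|h(u_l^* u_i u_j)| <= (w_ab w_ac w_bc)^(1/2) x_i x_j x_l]

    where [w_ab = (d_a d_b + d_(a-1) d_(b-1)) / d_(a+b)].  Hence [|h(u^3)|] is at
    most [Tr H^3] for the Hankel-like matrix [H_ab = w_ab^(1/2) x_(a+b)].  Now
    [H_00 = 0] and [w_0b = 1], so the rest of row 0 has norm [S]; and the [w_ab] with
    [a, b >= 1] and [a + b = k] sum up to [alpha_k - 1], so the block
    [(H_ab), a, b >= 1] has Hilbert-Schmidt norm [Q].  Expanding the trace along
    row 0 gives [3 S^2 Q + Q^3].

    The constant for a triple comes from the homomorphism of [H_(b+c)] into
    [H_(a+b) (x) H_(a+c)], built from the highest weight inclusion into
    [H_b (x) H_c] by inserting [a] times the invariant vector of [H_1 (x) H_1] in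
    the middle.  If [Psi] denotes this insertion, the Wenzl recursion yields

      [Psi^* Psi = d_(m+1)/d_m - d_(n-1)/d_n
                   + d_(m-1) d_(n-1) / (d_m d_n) Psi Psi^*]

    on [H_m (x) H_n], from which the norm of that homomorphism follows by induction
    on [a]. *)
Require Import Defs.
From HB Require Import structures.
From mathcomp Require Import all_boot all_order all_algebra.
From mathcomp Require Import reals.
From mathcomp Require boolp.
From mathcomp Require Import complex mxtens.
From mathcomp Require Import ring lra zify.

Set Implicit Arguments.
Unset Strict Implicit.
Unset Printing Implicit Defensive.

Import Order.TTheory GRing.Theory Num.Theory.
Local Open Scope ring_scope.
Local Open Scope complex_scope.

(** * Quantum integers *)

(** The exact constant of a triple does not factor over pairs of indices. With [d_a d_b / d_(a+b)]
    in place of [w_ab] the bound would fail by the factor [defect], which exceeds 1 once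
    [a, b, c >= 1]. The second summand of [w_ab] contributes a factor [1 + r_a r_b] with
    [r_k = d_(k-1) / d_k >= 1 / N]. Under the square root there are three such factors against
    [defect ^+ 2], and [defect <= 1 / (1 - N ^- 2)], so they win; the growth estimates behind this
    bound use [N >= 3]. The same summand makes the sums over [a + b = k] exact, because [U_k'] is a
    convolution of the [U_a].

    The norm of the homomorphism enters as follows. Inserting the invariant vector without
    normalizing composes with isometries on both sides, so the trilinear form [tau] stays
    contractive, while the squared norm of the homomorphism becomes [mu]. Homomorphisms from [H_l]
    are unique up to a scalar and [tau] is quadratic in them, hence the normalized one satisfies the
    bound with [1 / mu]. *)

Section Bracket.
Variables (R : comPzRingType) (x : R).

(* [bracket x k.+1] is [U_k] at [x], and [bracket x 0 = 0] stands for [U_-1]. *)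
Fixpoint bracket (k : nat) : R :=
  match k with
  | 0 => 0
  | (k'.+1 as k1).+1 => x * bracket k1 - bracket k'
  | _ => 1
  end.

Arguments bracket : simpl never.

Lemma bracket0 : bracket 0 = 0. Proof. by []. Qed.

Lemma bracket1 : bracket 1 = 1. Proof. by []. Qed.

Lemma bracketSS k : bracket k.+2 = x * bracket k.+1 - bracket k.
Proof. by []. Qed.

(** The addition formula of [sinh], for brackets read as [sinh (k t) / sinh t]. The recurrence has
    order two, so the induction carries two consecutive cases. *)
Lemma bracketD m n :
  bracket (m + n).+1 = bracket m.+1 * bracket n.+1 - bracket m * bracket n.
Proof.
suff: bracket (m + n).+1 = bracket m.+1 * bracket n.+1 - bracket m * bracket n /\
  bracket (m + n.+1).+1 =
    bracket m.+1 * bracket n.+2 - bracket m * bracket n.+1 by case.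
elim: n => [|n [IH0 IH1]].
  by rewrite addn0 addn1 (bracketSS m) (bracketSS 0) bracket0 bracket1; split; ring.
rewrite addnS in IH1; split; rewrite !addnS // (bracketSS (m + n).+1).
rewrite IH1 IH0 (bracketSS n.+1).
by rewrite (bracketSS n); ring.
Qed.

(** By [bracketD], replacing [m] by [m.+1] adds [bracket (2 m + b + c + 1)] to both products that
    contain [m]. Their difference is therefore its value at [m = 0]. *)
Lemma bracket_exchange m b c :
  bracket (m + b) * bracket (m + c) =
  bracket m * bracket (m + b + c) + bracket b * bracket c.
Proof.
elim: m => [|m IH]; first by rewrite !add0n bracket0; ring.
have H1 := bracketD (m + b) (m + c); have H2 := bracketD m (m + b + c).
have E : (m + b + (m + c) = m + (m + b + c))%N by lia.
rewrite E H2 in H1; rewrite !addSn.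
have -> : bracket (m + b).+1 * bracket (m + c).+1 =
  bracket m.+1 * bracket (m + b + c).+1 - bracket m * bracket (m + b + c) +
  bracket (m + b) * bracket (m + c) by rewrite H1; ring.
by rewrite IH; ring.
Qed.

(* The derivative of [U_k] at [x]. *)
Definition bracket_conv k : R := \sum_(a < k) bracket a.+1 * bracket (k - a).

Lemma bracket_convSS k :
  bracket_conv k.+2 =
  x * bracket_conv k.+1 - bracket_conv k + bracket k.+2.
Proof.
rewrite /bracket_conv big_ord_recr /= subSnn bracket1 mulr1.
rewrite (eq_bigr (fun a : 'I_k.+1 => x * (bracket a.+1 * bracket (k.+1 - a)) -
   bracket a.+1 * bracket (k - a))); last first.
  move=> a _; have la : (a <= k)%N by rewrite -ltnS.
  have -> : (k.+2 - a = (k - a).+2)%N by lia.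
  have -> : (k.+1 - a = (k - a).+1)%N by lia.
  by rewrite (bracketSS (k - a)); ring.
rewrite sumrB -mulr_sumr [X in _ - X]big_ord_recr /= subnn bracket0 mulr0 addr0.
by [].
Qed.

End Bracket.
Arguments bracket {R} x k : simpl never.

(** * Growth of quantum integers and bounds on the fusion constants *)

Section Bounds.
Variables (R : realFieldType) (x : R).
Hypothesis x3 : 3 <= x.
Notation "[ k ]q" := (bracket x k) (format "[ k ]q").

(** The recurrence yields the next growth bound once [[k]q <= [k.+1]q], and this follows from
    positivity together with the current growth bound. *)
Lemma bracket_ge0_growth k : 0 <= [k]q /\ (x - 1) * [k]q <= [k.+1]q.
Proof.
have hx := x3.
elim: k => [|k [IH0 IH1]]; first by rewrite bracket0 bracket1; split; lra.
have IH2 : 0 <= (x - 3) * [k]q by rewrite mulr_ge0 // subr_ge0.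
split; first lra.
by rewrite bracketSS; lra.
Qed.

Lemma bracket_ge0 k : 0 <= [k]q. Proof. by case: (bracket_ge0_growth k). Qed.

Lemma bracket_growth k : (x - 1) * [k]q <= [k.+1]q.
Proof. by case: (bracket_ge0_growth k). Qed.

Lemma bracket_gt0 k : 0 < [k.+1]q.
Proof.
have hx := x3.
elim: k => [|k IH]; first by rewrite bracket1 ltr01.
apply: lt_le_trans (bracket_growth k.+1); rewrite mulr_gt0 //; lra.
Qed.

Lemma bracket_leS k : [k.+1]q <= x * [k]q + (k == 0%N)%:R.
Proof.
have hx := x3.
case: k => [|k]; first by rewrite bracket0 bracket1 /=; lra.
by rewrite bracketSS /=; have := bracket_ge0 k; lra.
Qed.

(** By [bracketD], [[m.+1]q * [n.+1]q] is [[(m + n).+1]q + [m]q * [n]q]; growth by a factor of at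
    least 2 absorbs the second term. *)
Lemma bracket_mul_le m n : [m]q * [n]q <= [m + n]q.
Proof.
have hx := x3.
case: m => [|m]; first by rewrite bracket0 mul0r bracket_ge0.
case: n => [|n]; first by rewrite bracket0 mulr0 bracket_ge0.
rewrite addSn addnS bracketSS.
have E := bracketD x m n.
have E1 := bracket_growth (m + n); have E2 := bracket_growth (m + n).+1.
have H0 := bracket_ge0 (m + n).+1; have H1 := bracket_ge0 (m + n).
have H : [m]q * [n]q <= [m + n]q.
  elim: m {E E1 E2 H0 H1} n => [|m IH] n.
    by rewrite bracket0 mul0r bracket_ge0.
  case: n => [|n]; first by rewrite bracket0 mulr0 bracket_ge0.
  have E := bracketD x m n.
  rewrite addSn addnS.
  have := IH n; have := bracket_growth (m + n).+1.
  have := bracket_growth (m + n); have := bracket_ge0 (m + n).+1.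
  by have := bracket_ge0 (m + n); nra.
nra.
Qed.

Lemma bracket_shift_le j k : 2 ^+ j * [k]q <= [k + j]q.
Proof.
have hx := x3.
elim: j => [|j IH]; first by rewrite addn0 expr0 mul1r.
rewrite addnS exprS -mulrA; have := bracket_growth (k + j).
by have := bracket_ge0 (k + j); nra.
Qed.

(* [mu a b c] is the squared norm of the vector obtained by applying [a] creation
   operators to a unit highest weight vector of [H_b (x) H_c] ([tower_gram]). *)
Definition nu a b c : R :=
  [a.+1]q * [(a + b + c).+2]q / ([(a + b).+1]q * [(a + c).+1]q).

Fixpoint mu a b c : R := if a is a'.+1 then nu a' b c * mu a' b c else 1.

Lemma nu_gt0 a b c : 0 < nu a b c.
Proof. by rewrite divr_gt0 ?mulr_gt0 ?bracket_gt0. Qed.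

Lemma mu_gt0 a b c : 0 < mu a b c.
Proof. by elim: a => [|a IH]; rewrite /= ?ltr01 // mulr_gt0 // nu_gt0. Qed.

Lemma nu0 b c : nu 0 b c = [b.+2]q / [b.+1]q - [c]q / [c.+1]q.
Proof.
have Hb := bracket_gt0 b; have Hc := bracket_gt0 c.
rewrite /nu !add0n -addSn bracketD bracketSS bracket1 mul1r.
by field; rewrite !gt_eqF.
Qed.

(** The coefficients are those of [annihilate_create_SS] with [m = a + b] and [n = a + c]. The
    identity compares two expansions of one bracket by [bracketD], along [(a + b).+2 + (a + c).+1]
    and [a.+1 + (a + b + c).+2]. *)
Lemma nuS a b c :
  nu a.+1 b c = [(a + b).+3]q / [(a + b).+2]q - [(a + c).+1]q / [(a + c).+2]q +
    [(a + b).+1]q * [(a + c).+1]q / ([(a + b).+2]q * [(a + c).+2]q) * nu a b c.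
Proof.
have H1 := bracket_gt0 (a + b); have H2 := bracket_gt0 (a + c).
have H3 := bracket_gt0 (a + b).+1; have H4 := bracket_gt0 (a + c).+1.
have E1 := bracketD x (a + b).+2 (a + c).+1.
have E2 := bracketD x a.+1 (a + b + c).+2.
have E : ((a + b).+2 + (a + c).+1 = a.+1 + (a + b + c).+2)%N by lia.
rewrite E E2 in E1; rewrite /nu !addSn.
suff -> : [a.+2]q * [(a + b + c).+3]q =
  [(a + b).+3]q * [(a + c).+2]q - [(a + b).+2]q * [(a + c).+1]q +
  [a.+1]q * [(a + b + c).+2]q by field; rewrite !gt_eqF.
by rewrite -E1; ring.
Qed.

(* These numbers majorize the fusion constants multiplicatively
   ([fusion_constant_le]), and those with [a, b >= 1] and [a + b = k] sum up to
   exactly [alpha_k - 1] ([weight2_sum]). *)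
Definition weight2 a b : R := ([a.+1]q * [b.+1]q + [a]q * [b]q) / [(a + b).+1]q.

Lemma weight2_ge0 a b : 0 <= weight2 a b.
Proof. by rewrite divr_ge0 ?addr_ge0 ?mulr_ge0 ?bracket_ge0. Qed.

Lemma weight20 b : weight2 0 b = 1.
Proof.
by rewrite /weight2 add0n bracket0 bracket1 mul0r addr0 mul1r divff // gt_eqF ?bracket_gt0.
Qed.

(* Ratio of the exact fusion constant to the product of the three factors
   [d_a d_b / d_(a+b)], which is its value when [a b c = 0]. *)
Definition defect a b c : R :=
  [(a + b).+1]q * [(a + c).+1]q / ([a.+1]q * [b.+1]q * [c.+1]q * mu a b c).

Lemma defect0 b c : defect 0 b c = 1.
Proof.
rewrite /defect !add0n /= bracket1 mulr1 mul1r divff //.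
by rewrite mulf_neq0 // gt_eqF ?bracket_gt0.
Qed.

(** The quotient of consecutive values is [[(a + b).+2]q * [(a + c).+2]q / ([a.+2]q *
    [(a + b + c).+2]q)], whose numerator splits by [bracket_exchange]. *)
Lemma defectS a b c : defect a.+1 b c =
  (1 + [b]q * [c]q / ([a.+2]q * [(a + b + c).+2]q)) * defect a b c.
Proof.
have E := bracket_exchange x a.+2 b c.
rewrite !addSn in E.
have H1 := bracket_gt0 a; have H2 := bracket_gt0 b; have H3 := bracket_gt0 c.
have H4 := bracket_gt0 a.+1; have H5 := bracket_gt0 (a + b + c).+1.
have H6 := mu_gt0 a b c; have H7 := bracket_gt0 (a + b).
have H8 := bracket_gt0 (a + c).
have H9 := bracket_gt0 (a + b).+1.
have H10 := bracket_gt0 (a + c).+1.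
rewrite /defect /= /nu !addSn E; field.
by rewrite !gt_eqF.
Qed.

Lemma defect_gt0 a b c : 0 < defect a b c.
Proof. by rewrite divr_gt0 ?mulr_gt0 ?mu_gt0 ?bracket_gt0. Qed.

(** The factor [3 / 4] makes the bounds sum up to [x ^- 2] over all [a]. In the denominator,
    [[a.+2]q] is at least [2 ^+ a * x] and the other bracket at least [2 ^+ a * (x - 1) ^+ 2 * [b]q
    * [c]q]. *)
Lemma defect_step a b c :
  [b]q * [c]q / ([a.+2]q * [(a + b + c).+2]q) <= 3 / 4 * x ^- 2 * 4 ^- a.
Proof.
have hx := x3.
have H1 := bracket_shift_le a 2; have H2 := bracket_shift_le a (b + c).+2.
rewrite ler_pdivrMr ?mulr_gt0 ?bracket_gt0 //.
have E : (a + b + c).+2 = ((b + c).+2 + a)%N by lia.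
rewrite E -addn2 addnC; set t : R := 2 ^+ a in H1 H2.
have tE : 4 ^- a = t ^- 2 :> R.
  by rewrite /t -exprM mulnC exprM; congr ((_ ^+ _)^-1); ring.
have t0 : 0 < t by rewrite exprn_gt0.
have x0 : 0 < x by lra.
have H : x * ((x - 1) ^+ 2 * ([b]q * [c]q)) * t ^+ 2 <=
    [2 + a]q * [(b + c).+2 + a]q.
  apply: (@le_trans _ _ ((t * [2]q) * (t * [(b + c).+2]q))); last first.
    by rewrite ler_pM ?mulr_ge0 ?bracket_ge0 // ltW.
  rewrite (_ : [2]q = x); last by rewrite bracketSS bracket0 bracket1; ring.
  suff h : (x - 1) ^+ 2 * ([b]q * [c]q) <= [(b + c).+2]q.
    have := ler_wpM2l (mulr_ge0 (ltW x0) (exprn_ge0 2 (ltW t0))) h.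
    by congr (_ <= _); ring.
  have := bracket_growth (b + c).+1; have := bracket_growth (b + c).
  have := bracket_mul_le b c; have := bracket_ge0 (b + c).
  have x10 : 0 <= x - 1 by lra.
  move=> h1 h2 h3 h4; apply: le_trans h4.
  by rewrite expr2 -mulrA ler_wpM2l // (le_trans _ h3) // ler_wpM2l.
apply: (@le_trans _ _ (3 / 4 * x ^- 2 * 4 ^- a *
  (x * ((x - 1) ^+ 2 * ([b]q * [c]q)) * t ^+ 2))); last first.
  by rewrite ler_wpM2l // !mulr_ge0 // ?invr_ge0 ?exprn_ge0 // ltW.
rewrite tE; have bc0 : 0 <= [b]q * [c]q by rewrite mulr_ge0 ?bracket_ge0.
rewrite (_ : _ * (x * _ * _) = 3 / 4 * (x - 1) ^+ 2 / x * ([b]q * [c]q)); last first.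
  by field; rewrite !gt_eqF.
rewrite -[X in X <= _]mul1r ler_wpM2r // ler_pdivlMr // mul1r.
(* What remains is [4 x <= 3 (x - 1) ^+ 2], an equality at [x = 3]. *)
by nra.
Qed.

Lemma defect_le a b c : defect a b c * (1 - x ^- 2) <= 1.
Proof.
have hx := x3.
have x0 : 0 < x by lra.
have y0 : 0 < x ^- 2 by rewrite invr_gt0 exprn_gt0.
have y1 : x ^- 2 <= 1 by rewrite invf_le1 ?exprn_gt0 //; nra.
have p_pos k : 0 <= 4 ^- k :> R by rewrite invr_ge0 exprn_ge0.
have p_le1 k : 4 ^- k <= 1 :> R.
  by rewrite invf_le1 ?exprn_gt0 // exprn_ege1 //; lra.
(* A product of factors [1 + z] is at most the inverse of one minus the sum of the [z]; here
   [x ^- 2 * (1 - 4 ^- a)] is the partial sum of the bounds in [defect_step]. The induction needs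
   the partial sums, not just their limit. *)
suff H : defect a b c * (1 - x ^- 2 * (1 - 4 ^- a)) <= 1.
  apply: le_trans H; rewrite ler_wpM2l ?(ltW (defect_gt0 _ _ _)) //.
  by have := p_pos a; nra.
elim: a => [|a IH]; first by rewrite defect0 expr0 invr1; lra.
rewrite defectS; set z := (X in 1 + X).
apply: le_trans IH; rewrite mulrAC mulrC.
rewrite ler_wpM2l ?(ltW (defect_gt0 _ _ _)) //.
have Hz : z <= 3 / 4 * x ^- 2 * 4 ^- a by exact: defect_step.
have z0 : 0 <= z.
  by rewrite divr_ge0 ?mulr_ge0 ?bracket_ge0.
move: Hz z0; move: (z) => {z} z Hz z0.
have E : 4 ^- a.+1 = 4 ^- a / 4 :> R by rewrite exprSr invfM mulrC.
rewrite E; move: (p_pos a) (p_le1 a) Hz y0 y1.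
move: (4 ^- a) (x ^- 2) => p y p0 p1 Hz y0 y1.
have : 0 <= z * (y * (1 - p / 4)).
  by apply: mulr_ge0 => //; apply: mulr_ge0; lra.
lra.
Qed.

Lemma bracket_ratio_ge k : [k]q / [k.+1]q >= (0 < k)%N%:R / x.
Proof.
have hx := x3.
have x0 : 0 < x by lra.
case: k => [|k]; first by rewrite bracket0 !mul0r.
rewrite ler_pdivlMr ?bracket_gt0 // mulrAC ler_pdivrMr // mul1r mulrC.
by have := bracket_leS k.+1; rewrite /= addr0.
Qed.

Lemma defect_degenerate a b c : (a * b * c = 0)%N -> defect a b c = 1.
Proof.
elim: a => [|a IH] H; first exact: defect0.
have /orP[/eqP Hb|/eqP Hc] : (b == 0%N) || (c == 0%N) by lia.
  by rewrite defectS Hb bracket0 !mul0r addr0 mul1r -Hb IH // Hb muln0.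
by rewrite defectS Hc bracket0 mulr0 mul0r addr0 mul1r -Hc IH // Hc muln0.
Qed.

Lemma defect_sqr_le a b c : defect a b c ^+ 2 <=
  (1 + [a]q / [a.+1]q * ([b]q / [b.+1]q)) *
  (1 + [a]q / [a.+1]q * ([c]q / [c.+1]q)) *
  (1 + [b]q / [b.+1]q * ([c]q / [c.+1]q)).
Proof.
have hx := x3.
have r0 k : 0 <= [k]q / [k.+1]q by rewrite divr_ge0 ?bracket_ge0.
have r1 m n : 0 <= [m]q / [m.+1]q * ([n]q / [n.+1]q) by rewrite mulr_ge0.
have ge1 m n : 1 <= 1 + [m]q / [m.+1]q * ([n]q / [n.+1]q).
  by have := r1 m n; lra.
(* If an index is 0, some factors on the right equal 1 and offer no surplus, but then [defect] is 1
   as well. *)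
have [/defect_degenerate ->|abc] := eqVneq (a * b * c)%N 0%N.
  by rewrite expr1n -[X in X <= _]mulr1 -{1}[1]mulr1 !ler_pM ?mulr_ge0.
have x0 : 0 < x by lra.
have rx k : (0 < k)%N -> x^-1 <= [k]q / [k.+1]q.
  by move=> k0; have := bracket_ratio_ge k; rewrite k0 mul1r.
have xV0 : 0 <= x^-1 by rewrite invr_ge0 ltW.
have rxx m n : (0 < m)%N -> (0 < n)%N ->
    1 + x ^- 2 <= 1 + [m]q / [m.+1]q * ([n]q / [n.+1]q).
  by move=> m0 n0; rewrite lerD2l expr2 invfM ler_pM ?rx.
have y0 : 0 < x ^- 2 by rewrite invr_gt0 exprn_gt0.
have y9 : x ^- 2 <= 1 / 9.
  by rewrite -[X in X <= _]mul1r ler_pdivrMr ?exprn_gt0 //; nra.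
apply: (@le_trans _ _ ((1 + x ^- 2) * (1 + x ^- 2) * (1 + x ^- 2))); last first.
  by rewrite !ler_pM ?rxx ?mulr_ge0 ?addr_ge0 ?ltW //; lia.
have := defect_le a b c; have := defect_gt0 a b c.
move: y0 y9; set y := x ^- 2; set g := defect a b c => y0 y9 g0 g1.
have g2 : (g * (1 - y)) ^+ 2 <= 1.
  by rewrite expr_le1 // mulr_ge0 //; lra.
(* To first order this is [1 + 3 y - 2 y]; the higher terms are controlled by [y <= 1 / 9]. *)
have : 1 <= (1 + y) ^+ 3 * (1 - y) ^+ 2.
  rewrite (_ : _ * _ = 1 + y * (1 - 2 * y - 2 * y ^+ 2 + y ^+ 3 + y ^+ 4)).
    by rewrite lerDl mulr_ge0 ?ltW //; nra.
  by ring.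
have y1 : 0 < (1 - y) ^+ 2 by rewrite exprn_gt0 //; lra.
move=> h; have h2 := le_trans g2 h.
rewrite -(ler_pM2r y1) -exprMn (le_trans h2) //.
by rewrite [X in _ <= X * _](_ : _ = (1 + y) ^+ 3) //; ring.
Qed.

(** The left side is the square of the constant reached in [haar_triple_le]. With [K] the product of
    the three [d_a d_b / d_(a+b)], both sides are [K] times those of [defect_sqr_le]. *)
Lemma fusion_constant_le a b c :
  [(a + b).+1]q * [(a + c).+1]q / [(b + c).+1]q / mu a b c ^+ 2 <=
  weight2 a b * weight2 a c * weight2 b c.
Proof.
have H1 := bracket_gt0 a; have H2 := bracket_gt0 b; have H3 := bracket_gt0 c.
have H4 := bracket_gt0 (a + b); have H5 := bracket_gt0 (a + c).
have H6 := bracket_gt0 (b + c); have H7 := mu_gt0 a b c.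
have H := defect_sqr_le a b c.
pose K := ([a.+1]q * [b.+1]q * [c.+1]q) ^+ 2 /
  ([(a + b).+1]q * [(a + c).+1]q * [(b + c).+1]q).
have K0 : 0 < K by rewrite divr_gt0 ?exprn_gt0 ?mulr_gt0.
move: H; rewrite -(ler_pM2l K0).
rewrite (_ : K * defect a b c ^+ 2 =
  [(a + b).+1]q * [(a + c).+1]q / [(b + c).+1]q / mu a b c ^+ 2); last first.
  by rewrite /K /defect; field; rewrite !gt_eqF.
rewrite (_ : K * _ = weight2 a b * weight2 a c * weight2 b c) //.
by rewrite /K /weight2; field; rewrite !gt_eqF.
Qed.

(** The numerators form two convolutions: [bracket_conv] at [k + 1] without its two end terms, and
    [bracket_conv] at [k - 1]. The recurrence [bracket_convSS] merges them into the one at [k]. *)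
Lemma weight2_sum k : (0 < k)%N ->
  \sum_(a < k.-1) weight2 a.+1 (k - a.+1) = x * bracket_conv x k / [k.+1]q - 1.
Proof.
case: k => [//|k _]; rewrite [k.+1.-1]/=.
have k0 := bracket_gt0 k.+1.
suff H : \sum_(a < k) ([a.+2]q * [(k - a).+1]q + [a.+1]q * [k - a]q) =
    x * bracket_conv x k.+1 - [k.+2]q.
  rewrite (eq_bigr (fun a : 'I_k => ([a.+2]q * [(k - a).+1]q +
     [a.+1]q * [k - a]q) / [k.+2]q)); last first.
    move=> a _; have la := ltn_ord a.
    rewrite /weight2 subSS; congr (_ / [_]q); lia.
  by rewrite -mulr_suml H mulrBl divff // gt_eqF.
have E := bracket_convSS x k.
rewrite big_split /= -/(bracket_conv x k).
rewrite (_ : x * _ = bracket_conv x k.+2 + bracket_conv x k - [k.+2]q); last first.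
  by rewrite E; ring.
rewrite /bracket_conv big_ord_recl big_ord_recr /= subSnn bracket1 mulr1 mul1r subn0.
rewrite [X in _ = _ + (X + _) + _ - _ - _]
  (eq_bigr (fun a : 'I_k => [a.+2]q * [(k - a).+1]q)); last first.
  by move=> a _; have la := ltn_ord a; congr (_ * [_]q); rewrite /bump /=; lia.
rewrite -[(bump 0 k).+1]/(k.+2); ring.
Qed.

End Bounds.

Section Chebyshev.
Variable R : realType.

Lemma chebUSS k : chebU R k.+2 = 'X * chebU R k.+1 - chebU R k.
Proof. by []. Qed.

Lemma chebU_horner x k : (chebU R k).[x] = bracket x k.+1.
Proof.
suff: (chebU R k).[x] = bracket x k.+1 /\ (chebU R k.+1).[x] = bracket x k.+2.
  by case.
elim: k => [|k [IH0 IH1]].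
  by rewrite hornerX hornerC bracketSS bracket0 bracket1; split; ring.
split=> //.
by rewrite chebUSS hornerD hornerN hornerM hornerX IH0 IH1 (bracketSS x k.+1).
Qed.

Lemma chebU_deriv_horner x k : (chebU R k)^`().[x] = bracket_conv x k.
Proof.
suff: (chebU R k)^`().[x] = bracket_conv x k /\
      (chebU R k.+1)^`().[x] = bracket_conv x k.+1 by case.
elim: k => [|k [IH0 IH1]].
  rewrite derivX derivC !hornerC /bracket_conv big_ord0 big_ord1 /=.
  by rewrite subn0 bracket1 mulr1.
split=> //; rewrite chebUSS derivD derivN derivM derivX mul1r.
rewrite !hornerD hornerN hornerM hornerX IH0 IH1 chebU_horner bracket_convSS.
by ring.
Qed.

Lemma alphaE N k :
  alpha R N k = N%:R * bracket_conv N%:R k / bracket N%:R k.+1.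
Proof. by rewrite /alpha chebU_horner chebU_deriv_horner. Qed.

End Chebyshev.

(** * The Hankel matrix inequality *)

Section CauchySchwarz.
Variable R : rcfType.

Lemma le_sum_term (I : finType) (F : I -> R) i :
  (forall j, 0 <= F j) -> F i <= \sum_j F j.
Proof. by move=> F0; rewrite (bigD1 i) //= lerDl sumr_ge0. Qed.

Lemma sum_cauchy_schwarz (I : finType) (f g : I -> R) :
  (\sum_i f i * g i) ^+ 2 <= (\sum_i f i ^+ 2) * (\sum_i g i ^+ 2).
Proof.
set A := \sum_i f i ^+ 2; set B := \sum_i g i ^+ 2; set D := \sum_i f i * g i.
have A0 : 0 <= A by apply: sumr_ge0 => i _; exact: sqr_ge0.
have quad t : 0 <= A - 2 * t * D + t ^+ 2 * B.
  rewrite (_ : _ + _ = \sum_i (f i - t * g i) ^+ 2).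
    by apply: sumr_ge0 => i _; exact: sqr_ge0.
  rewrite /A /B /D !mulr_sumr -sumrB -big_split /=.
  by apply: eq_bigr => i _; ring.
have [B0|B0] := eqVneq B 0.
  have g0 i : g i = 0.
    apply/eqP; rewrite -sqrf_eq0; apply/eqP.
    by apply: (psumr_eq0P (fun i _ => sqr_ge0 (g i)) B0).
  by rewrite /D big1 ?expr0n ?mulr_ge0 ?B0 // => i _; rewrite g0 mulr0.
have Bp : 0 < B by rewrite lt_neqAle eq_sym B0 sumr_ge0 // => i _; exact: sqr_ge0.
have := quad (D / B); rewrite -(ler_pM2r Bp) mul0r.
rewrite [X in 0 <= X](_ : _ = A * B - D ^+ 2); last by field.
by rewrite subr_ge0.
Qed.

Lemma sum_le_mul (I : finType) (f g : I -> R) (p q : R) : 0 <= p -> 0 <= q ->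
  \sum_i f i ^+ 2 <= p ^+ 2 -> \sum_i g i ^+ 2 <= q ^+ 2 ->
  \sum_i f i * g i <= p * q.
Proof.
move=> p0 q0 hf hg; have [/ltW h|h] := ltP (\sum_i f i * g i) 0.
  by rewrite (le_trans h) ?mulr_ge0.
rewrite -(@ler_pXn2r _ 2) ?nnegrE ?mulr_ge0 // (le_trans (sum_cauchy_schwarz _ _)) //.
by rewrite exprMn ler_pM // sumr_ge0 // => i _; exact: sqr_ge0.
Qed.

Lemma sum_form_le (I : finType) (v : I -> R) (M : I -> I -> R) (s q : R) :
  0 <= q -> \sum_a v a ^+ 2 <= s ^+ 2 ->
  \sum_a \sum_b M a b ^+ 2 <= q ^+ 2 ->
  \sum_a \sum_b v a * v b * M a b <= s ^+ 2 * q.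
Proof.
move=> q0 hv hM; rewrite pair_big /=.
apply: (@sum_le_mul _ (fun p : I * I => v p.1 * v p.2) (fun p => M p.1 p.2)).
- exact: sqr_ge0.
- by [].
- rewrite -(pair_bigA _ (fun a b => (v a * v b) ^+ 2)) /=.
  under eq_bigr do under eq_bigr do rewrite exprMn.
  under eq_bigr do rewrite -mulr_sumr.
  by rewrite -mulr_suml -expr2 lerXn2r // nnegrE ?sqr_ge0 ?sumr_ge0 // => i _;
     exact: sqr_ge0.
- by rewrite -(pair_bigA _ (fun a b => M a b ^+ 2)).
Qed.

(** Cauchy-Schwarz is used twice: over the pairs [(a, b)], for [M a b] against the inner product of
    rows [a] and [b], and within each of these inner products. *)
Lemma sum_cube_le (I : finType) (M : I -> I -> R) (q : R) : 0 <= q ->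
  \sum_a \sum_b M a b ^+ 2 <= q ^+ 2 ->
  \sum_a \sum_b \sum_c M a b * M a c * M b c <= q ^+ 3.
Proof.
move=> q0 hM; rewrite pair_big /= exprS.
under eq_bigr do [under eq_bigr do rewrite -mulrA; rewrite -mulr_sumr].
apply: (@sum_le_mul _ (fun p : I * I => M p.1 p.2)
  (fun p => \sum_c M p.1 c * M p.2 c)) => //; first exact: sqr_ge0.
  by rewrite -(pair_bigA _ (fun a b => M a b ^+ 2)).
rewrite -(pair_bigA _ (fun a b => (\sum_c M a c * M b c) ^+ 2)) /=.
apply: (@le_trans _ _ (\sum_a \sum_b
    (\sum_c M a c ^+ 2) * (\sum_c M b c ^+ 2))).
  by apply: ler_sum => a _; apply: ler_sum => b _; exact: sum_cauchy_schwarz.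
under eq_bigr do rewrite -mulr_sumr.
rewrite -mulr_suml -expr2 lerXn2r // nnegrE ?sqr_ge0 //.
by apply: sumr_ge0 => a _; apply: sumr_ge0 => b _; exact: sqr_ge0.
Qed.

(* Splitting off index 0: [H 0 0 = 0] kills the terms with two or three zero
   indices, and the terms with a single one form the quadratic part. *)
Lemma bordered_cube_le n (H : nat -> nat -> R) (s q : R) : 0 <= q ->
  (forall a b, H a b = H b a) -> H 0%N 0%N = 0 ->
  \sum_(b < n) H 0%N b.+1 ^+ 2 <= s ^+ 2 ->
  \sum_(a < n) \sum_(b < n) H a.+1 b.+1 ^+ 2 <= q ^+ 2 ->
  \sum_(a < n.+1) \sum_(b < n.+1) \sum_(c < n.+1) H a b * H a c * H b c <=
  3 * s ^+ 2 * q + q ^+ 3.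
Proof.
move=> q0 Hsym H00 hs hq.
have h3 := sum_cube_le q0 hq.
have h2 := @sum_form_le _ (fun b : 'I_n => H 0%N b.+1)
  (fun a b : 'I_n => H a.+1 b.+1) s q q0 hs hq.
set t3 := (X in X <= _) in h3; set t2 := (X in X <= _) in h2.
suff -> : \sum_(a < n.+1) \sum_(b < n.+1) \sum_(c < n.+1) H a b * H a c * H b c
    = 3 * t2 + t3 by lra.
pose G a b c := H a b * H a c * H b c.
have G1 a c : G a 0%N c = H 0%N a * H 0%N c * H a c.
  by rewrite /G (Hsym a 0%N); ring.
have split3 a : \sum_(b < n.+1) \sum_(c < n.+1) G a b c =
    G a 0%N 0%N + \sum_(c < n) G a 0%N c.+1 + (\sum_(b < n) G a b.+1 0%N +
    \sum_(b < n) \sum_(c < n) G a b.+1 c.+1).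
  rewrite big_ord_recl [X in X + _]big_ord_recl; congr (_ + _).
  by rewrite -big_split; apply: eq_bigr => b _; rewrite big_ord_recl.
transitivity (\sum_(a < n.+1) \sum_(b < n.+1) \sum_(c < n.+1) G a b c) => //.
rewrite (eq_bigr _ (fun (a : 'I_n.+1) _ => split3 a)) big_ord_recl /=.
have -> : G 0%N 0%N 0%N = 0 by rewrite /G H00 !mul0r.
rewrite [X in 0 + X]big1 ?add0r; last by move=> c _; rewrite /G H00 !mul0r.
rewrite [X in X + _ + _]big1 ?add0r; last by move=> c _; rewrite /G H00 mulr0 mul0r.
rewrite !big_split /= [X in _ + (X + _ + _)]big1 ?add0r; last first.
  by move=> a _; rewrite /G H00 mulr0.
rewrite -/t3.
have E1 : \sum_(b < n) \sum_(c < n) G 0%N b.+1 c.+1 = t2 by [].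
have E2 : \sum_(a < n) \sum_(c < n) G a.+1 0%N c.+1 = t2.
  by apply: eq_bigr => a _; apply: eq_bigr => c _; rewrite G1.
have E3 : \sum_(a < n) \sum_(b < n) G a.+1 b.+1 0%N = t2.
  apply: eq_bigr => a _; apply: eq_bigr => b _.
  by rewrite /G (Hsym _ 0%N) (Hsym b.+1 0%N); ring.
by rewrite E1 E2 E3; ring.
Qed.

End CauchySchwarz.

(** * From triples of degrees to the Hankel matrix *)

Section HankelSum.
Variables (R : realType) (N : nat).
Hypothesis N3 : (3 <= N)%N.
Let x3 : 3 <= N%:R :> R. Proof. by rewrite ler_nat. Qed.
Notation W := (weight2 (N%:R : R)).
Notation alpha := (alpha R N).

Lemma weight2C a b : W a b = W b a.
Proof. by rewrite /weight2 addnC; congr (_ / _); ring. Qed.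

Lemma weight2_sum_alpha n k : (0 < k)%N -> (k <= n)%N ->
  \sum_(a < n | (a.+1 < k)%N) W a.+1 (k - a.+1) = alpha k - 1.
Proof.
move=> k0 kn; rewrite alphaE -weight2_sum //.
rewrite [RHS](big_ord_widen n (fun a => W a.+1 (k - a.+1))); last by lia.
by apply: eq_bigl => a; lia.
Qed.

Lemma hankel_sum_le n (y : nat -> R) (T : nat -> nat -> nat -> R) (s q : R) :
  0 <= q -> (forall k, 0 <= y k) -> y 0%N = 0 ->
  \sum_(k < n.+1) y k ^+ 2 = s ^+ 2 ->
  \sum_(k < n.+1) (alpha k - 1) * y k ^+ 2 = q ^+ 2 ->
  (forall a b c, T (a + b)%N (a + c)%N (b + c)%N <=
    Num.sqrt (W a b * W a c * W b c) * y (a + b)%N * y (a + c)%N * y (b + c)%N) ->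
  (forall i j l, (forall a b c, i = (a + b)%N -> j = (a + c)%N ->
     l = (b + c)%N -> False) -> T i j l <= 0) ->
  \sum_(i < n.+1) \sum_(j < n.+1) \sum_(l < n.+1) T i j l <=
  3 * s ^+ 2 * q + q ^+ 3.
Proof.
move=> q0 y0 y00 hs hq hT hT0.
have W0 a b : 0 <= W a b by exact: weight2_ge0.
(* Entries of degree beyond [n] are cut off: no triple in the sum involves them, and the
   Hilbert-Schmidt norm of the remaining ones is a sum over the degrees up to [n]. *)
pose H a b : R := if (a + b < n.+1)%N then Num.sqrt (W a b) * y (a + b)%N else 0.
have H0 a b : 0 <= H a b.
  by rewrite /H; case: ifP => // _; rewrite mulr_ge0 ?sqrtr_ge0.
pose G a b c := H a b * H a c * H b c.
have G0 a b c : 0 <= G a b c by rewrite !mulr_ge0.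
have sqM a b c : Num.sqrt (W a b * W a c * W b c) =
    Num.sqrt (W a b) * Num.sqrt (W a c) * Num.sqrt (W b c).
  by rewrite (sqrtrM _ (mulr_ge0 (W0 a b) (W0 a c))) (sqrtrM _ (W0 a b)).
(* Writing the parametrization of [(i, j, l)] by [(a, b, c)] as a sum with indicators allows the
   summations to be exchanged. An over-count would be harmless since [G] is nonnegative. *)
have TG i j l : (i < n.+1)%N -> (j < n.+1)%N -> (l < n.+1)%N ->
    T i j l <= \sum_(a < n.+1) \sum_(b < n.+1) \sum_(c < n.+1)
      [&& i == a + b, j == a + c & l == b + c]%N%:R * G a b c.
  move=> li lj ll.
  have F0 (a b c : 'I_n.+1) :
      0 <= [&& i == a + b, j == a + c & l == b + c]%N%:R * G a b c.
    by rewrite mulr_ge0 ?ler0n.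
  have [/existsP[a /existsP[b /existsP[c /and3P[/eqP Ei /eqP Ej /eqP El]]]]|] :=
      boolP [exists a : 'I_n.+1, exists b : 'I_n.+1, exists c : 'I_n.+1,
        [&& i == a + b, j == a + c & l == b + c]%N].
    apply: (@le_trans _ _ (G a b c)).
      rewrite /G /H -Ei -Ej -El li lj ll {1}Ei {1}Ej {1}El.
      apply: le_trans (hT _ _ _) _; rewrite -Ei -Ej -El.
      by rewrite sqM le_eqVlt; apply/orP; left; apply/eqP; ring.
    apply: le_trans (le_sum_term a _); last by move=> *; do 2!(apply: sumr_ge0 => ? _).
    apply: le_trans (le_sum_term b _); last by move=> *; apply: sumr_ge0.
    apply: le_trans (le_sum_term c _); last by [].
    by rewrite Ei Ej El !eqxx mul1r.
  move/existsP => nE; apply: (@le_trans _ _ 0).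
    apply: hT0 => a b c Ei Ej El; apply: nE.
    have la : (a < n.+1)%N by lia.
    have lb : (b < n.+1)%N by lia.
    have lc : (c < n.+1)%N by lia.
    exists (Ordinal la); apply/existsP; exists (Ordinal lb).
    by apply/existsP; exists (Ordinal lc); rewrite /= Ei Ej El !eqxx.
  by do 3!(apply: sumr_ge0 => ? _).
apply: (@le_trans _ _ (\sum_(a < n.+1) \sum_(b < n.+1) \sum_(c < n.+1) G a b c)).
  apply: (@le_trans _ _ (\sum_(i < n.+1) \sum_(j < n.+1) \sum_(l < n.+1)
      \sum_(a < n.+1) \sum_(b < n.+1) \sum_(c < n.+1)
      [&& i == a + b :> nat, j == a + c :> nat & l == b + c :> nat]%N%:R *
        G a b c)).
    by do 3!(apply: ler_sum => ? _); exact: TG.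
  under eq_bigr do under eq_bigr do rewrite exchange_big /=.
  under eq_bigr do rewrite exchange_big /=.
  rewrite exchange_big /=; apply: ler_sum => a _.
  under eq_bigr do under eq_bigr do rewrite exchange_big /=.
  under eq_bigr do rewrite exchange_big /=.
  rewrite exchange_big /=; apply: ler_sum => b _.
  under eq_bigr do under eq_bigr do rewrite exchange_big /=.
  under eq_bigr do rewrite exchange_big /=.
  rewrite exchange_big /=; apply: ler_sum => c _.
  have sum_delta m : \sum_(i < n.+1) (i == m :> nat)%:R <= 1 :> R.
    have [lm|lm] := ltnP m n.+1; last first.
      rewrite big1 // => i _; have li := ltn_ord i.
      by rewrite (_ : _ == _ = false) //; apply/eqP; lia.
    rewrite (bigD1 (Ordinal lm)) //= eqxx big1 ?addr0 // => i.
    by rewrite -val_eqE /= => /negbTE ->.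
  have sum_delta0 m : 0 <= \sum_(i < n.+1) (i == m :> nat)%:R :> R.
    by apply: sumr_ge0 => i _; exact: ler0n.
  rewrite (eq_bigr (fun i : 'I_n.+1 => (i == a + b :> nat)%N%:R *
     ((\sum_(j < n.+1) (j == a + c :> nat)%N%:R) *
      ((\sum_(l < n.+1) (l == b + c :> nat)%N%:R) * G a b c)))); last first.
    move=> i _; rewrite mulr_suml mulr_sumr; apply: eq_bigr => j _.
    rewrite mulr_suml !mulr_sumr; apply: eq_bigr => l _.
    by rewrite -!mulnb !natrM; ring.
  rewrite -mulr_suml -[X in _ <= X]mul1r ler_pM ?mulr_ge0 //.
  rewrite -[X in _ <= X]mul1r ler_pM ?mulr_ge0 //.
  by rewrite -[X in _ <= X]mul1r ler_pM.
have sq_H a b : (a + b < n.+1)%N -> H a b ^+ 2 = W a b * y (a + b)%N ^+ 2.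
  by rewrite /H => ->; rewrite exprMn sqr_sqrtr.
apply: bordered_cube_le => //.
- by move=> a b; rewrite /H addnC weight2C.
- by rewrite /H add0n y00 mulr0.
- rewrite -hs [X in _ <= X]big_ord_recl y00 expr0n add0r /=.
  rewrite (eq_bigr (fun b : 'I_n => y b.+1 ^+ 2)) // => b _.
  rewrite sq_H; first by rewrite weight20 // mul1r.
  by have := ltn_ord b.
(* The squared entries are regrouped along the antidiagonals [k.+1 = a.+1 + b.+1], on which
   [weight2_sum_alpha] evaluates the sum of the weights. *)
- rewrite -hq [X in _ <= X]big_ord_recl y00 expr0n mulr0 add0r /=.
  rewrite [X in _ <= X](eq_bigr (fun k : 'I_n => \sum_(a < n | (a.+1 < k.+1)%N)
    W a.+1 (k.+1 - a.+1) * y k.+1 ^+ 2)); last first.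
    by move=> k _; rewrite -mulr_suml weight2_sum_alpha // ltn_ord.
  rewrite [X in _ <= X](exchange_big_dep xpredT) //=; apply: ler_sum => a _.
  rewrite -(big_mkord xpredT (fun b => H a.+1 b.+1 ^+ 2)).
  rewrite -(big_mkord (fun k => (a.+1 < k.+1)%N)
     (fun k => W a.+1 (k.+1 - a.+1) * y k.+1 ^+ 2)).
  have la := ltn_ord a.
  rewrite [X in X <= _](@big_cat_nat _ _ _ (n - a.+1)) ?leq_subr //=.
  rewrite [X in _ + X]big_nat_cond [X in _ + X]big1 ?addr0; last first.
    by move=> b; rewrite /H => hb; rewrite ifF ?expr0n //; apply/negbTE; lia.
  rewrite [X in _ <= X](@big_cat_nat _ _ _ a.+1) //=.
  rewrite [X in _ <= X + _]big_nat_cond [X in _ <= X + _]big1 ?add0r; last first.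
    by move=> k hk; lia.
  rewrite -[X in index_iota X n]add0n big_addn.
  rewrite big_nat_cond [X in _ <= X]big_nat_cond.
  rewrite le_eqVlt; apply/orP; left; apply/eqP.
  apply: eq_big => [b|b hb]; first by lia.
  rewrite sq_H; last by lia.
  by congr (W _ _ * y _ ^+ 2); lia.
Qed.

End HankelSum.

(** * Hilbert-Schmidt norms *)

Section Adjoint.
Variable R : realType.
Notation C := R[i].

Lemma conjC_mxE m n (M : 'M[C]_(m, n)) i j : conjC_mx M i j = (M i j)^*%R.
Proof. by rewrite mxE. Qed.

Lemma adjC_mxE m n (M : 'M[C]_(m, n)) i j : adjC_mx M i j = (M j i)^*%R.
Proof. by rewrite !mxE. Qed.

Lemma adjC_mxK m n (M : 'M[C]_(m, n)) : adjC_mx (adjC_mx M) = M.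
Proof. by apply/matrixP => i j; rewrite !adjC_mxE conjCK. Qed.

Lemma adjC_mulmx m n p (M : 'M[C]_(m, n)) (M' : 'M[C]_(n, p)) :
  adjC_mx (M *m M') = adjC_mx M' *m adjC_mx M.
Proof. by rewrite /adjC_mx /conjC_mx map_mxM trmx_mul. Qed.

Lemma adjC_mxZ m n a (M : 'M[C]_(m, n)) : adjC_mx (a *: M) = a^*%R *: adjC_mx M.
Proof. by apply/matrixP => i j; rewrite !mxE rmorphM. Qed.

Lemma adjC_mx_sum m n (I : finType) (F : I -> 'M[C]_(m, n)) :
  adjC_mx (\sum_i F i) = \sum_i adjC_mx (F i).
Proof.
by apply/matrixP => i j; rewrite !(mxE, summxE) rmorph_sum;
  apply: eq_bigr => k _; rewrite !mxE.
Qed.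

Lemma adjC_conj_mx m n (M : 'M[C]_(m, n)) : adjC_mx (conjC_mx M) = M^T.
Proof. by apply/matrixP => i j; rewrite !mxE conjCK. Qed.

Lemma mxtrace_adjC n (M : 'M[C]_n) : \tr (adjC_mx M) = (\tr M)^*%R.
Proof. by rewrite rmorph_sum; apply: eq_bigr => i _; rewrite adjC_mxE. Qed.

Definition hs_sqr m n (M : 'M[C]_(m, n)) : C := \tr (adjC_mx M *m M).

Definition hs_norm m n (M : 'M[C]_(m, n)) : R := Num.sqrt (complex.Re (hs_sqr M)).

Lemma hs_dotE m n (M M' : 'M[C]_(m, n)) :
  \tr (adjC_mx M *m M') = \sum_i \sum_j (M i j)^*%R * M' i j.
Proof.
rewrite exchange_big; apply: eq_bigr => j _.
by rewrite mxE; apply: eq_bigr => i _; rewrite adjC_mxE.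
Qed.

Lemma hs_sqrE m n (M : 'M[C]_(m, n)) : hs_sqr M = \sum_i \sum_j `|M i j| ^+ 2.
Proof.
rewrite /hs_sqr hs_dotE; apply: eq_bigr => i _; apply: eq_bigr => j _.
by rewrite normCK mulrC.
Qed.

Lemma hs_sqr_ge0 m n (M : 'M[C]_(m, n)) : 0 <= hs_sqr M.
Proof. by rewrite hs_sqrE; do 2!(apply: sumr_ge0 => ? _); rewrite exprn_ge0. Qed.

Lemma hs_sqr_eq0 m n (M : 'M[C]_(m, n)) : hs_sqr M = 0 -> M = 0.
Proof.
rewrite hs_sqrE => M0; apply/matrixP => i j; rewrite mxE.
have h1 i' : 0 <= \sum_j `|M i' j| ^+ 2 :> C.
  by apply: sumr_ge0 => ? _; rewrite exprn_ge0.
have /(_ i isT) h2 := psumr_eq0P (fun i _ => h1 i) M0.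
have h3 j' : 0 <= `|M i j'| ^+ 2 :> C by rewrite exprn_ge0.
have /(_ j isT)/eqP := psumr_eq0P (fun j _ => h3 j) h2.
by rewrite sqrf_eq0 normr_eq0 => /eqP.
Qed.

Lemma hs_norm_ge0 m n (M : 'M[C]_(m, n)) : 0 <= hs_norm M.
Proof. exact: sqrtr_ge0. Qed.

Lemma ge0_ReK (z : C) : 0 <= z -> (complex.Re z)%:C = z.
Proof. by move=> z0; rewrite RRe_real // ger0_real. Qed.

Lemma Re_ge0 (z : C) : 0 <= z -> 0 <= complex.Re z.
Proof. by move=> z0; rewrite -ler0c ge0_ReK. Qed.

Lemma hs_norm_sqr m n (M : 'M[C]_(m, n)) : (hs_norm M ^+ 2)%:C = hs_sqr M.
Proof. by rewrite sqr_sqrtr ?ge0_ReK ?Re_ge0 ?hs_sqr_ge0. Qed.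

Lemma sum_real_complex (I : finType) (F : I -> R) :
  (\sum_i F i)%:C = \sum_i (F i)%:C.
Proof. exact: (rmorph_sum (real_complex R)). Qed.

Lemma norm_sum_le (I : finType) (F : I -> C) (r : I -> R) :
  (forall i, `|F i| <= (r i)%:C) -> `|\sum_i F i| <= (\sum_i r i)%:C.
Proof.
move=> h; rewrite sum_real_complex (le_trans (ler_norm_sum _ _ _)) //.
by apply: ler_sum => i _.
Qed.

Lemma norm_Re (z : C) : `|z| = (complex.Re `|z|)%:C.
Proof. by rewrite ge0_ReK. Qed.

Definition orthonormal_fam l m n (Phi : 'I_l -> 'M[C]_(m, n)) :=
  forall s t, \tr (adjC_mx (Phi s) *m Phi t) = (s == t)%:R.

Lemma bessel l m n (Phi : 'I_l -> 'M[C]_(m, n)) (M : 'M[C]_(m, n)) :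
  orthonormal_fam Phi ->
  \sum_p `|\tr (adjC_mx (Phi p) *m M)| ^+ 2 <= hs_sqr M.
Proof.
move=> onP; pose c p := \tr (adjC_mx (Phi p) *m M).
pose P := \sum_p c p *: Phi p.
have PM : \tr (adjC_mx P *m M) = \sum_p `|c p| ^+ 2.
  rewrite adjC_mx_sum mulmx_suml raddf_sum /=; apply: eq_bigr => p _.
  by rewrite adjC_mxZ -scalemxAl mxtraceZ normCK mulrC.
have PP : \tr (adjC_mx P *m P) = \sum_p `|c p| ^+ 2.
  rewrite -PM {2}/P mulmx_sumr raddf_sum /=.
  rewrite adjC_mx_sum mulmx_suml raddf_sum /=.
  apply: eq_bigr => p _.
  rewrite -scalemxAr mxtraceZ mulmx_suml raddf_sum /= (bigD1 p) //= big1.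
    rewrite addr0 adjC_mxZ -!scalemxAl !mxtraceZ onP eqxx mulr1 mulrC.
    by rewrite -/(c p).
  move=> q /negbTE qp.
  by rewrite adjC_mxZ -scalemxAl mxtraceZ onP qp mulr0.
have MP : \tr (adjC_mx M *m P) = \sum_p `|c p| ^+ 2.
  rewrite -[P]adjC_mxK -adjC_mulmx mxtrace_adjC PM rmorph_sum.
  by apply: eq_bigr => p _; rewrite /= conj_Creal // rpredX // normr_real.
have := hs_sqr_ge0 (M - P); rewrite /hs_sqr.
have -> : adjC_mx (M - P) = adjC_mx M - adjC_mx P.
  by apply/matrixP => i j; rewrite !mxE rmorphB.
by rewrite mulmxBl !mulmxBr !raddfB /= MP PM PP opprK addNr addr0 subr_ge0.
Qed.

(* A homomorphism [Phi] from [H_l] to [H_m (x) H_n] contracted with its adjoint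
   against [Z], [X] and [Y]; the Haar state of a product of three coefficients has
   this form ([haar_triple]). *)
Definition tau l m n (Phi : 'I_l -> 'M[C]_(m, n)) (Z : 'M[C]_l)
    (X : 'M[C]_m) (Y : 'M[C]_n) : C :=
  \sum_a \sum_p (Z a p)^*%R * \tr (adjC_mx (Phi p) *m X *m Phi a *m Y).

Definition tau_contractive l m n (Phi : 'I_l -> 'M[C]_(m, n)) :=
  forall Z X Y, `|tau Phi Z X Y| <= (hs_norm Z * hs_norm X * hs_norm Y)%:C.

(** Up to conjugation, entry [(i, j)] of [X *m Phi a *m Y] is the inner product of [Phi a] with a
    rank-one matrix made of row [i] of [X] and column [j] of [Y]; Bessel's inequality then bounds
    the sum over [a]. *)
Lemma orthonormal_sandwich l m n (Phi : 'I_l -> 'M[C]_(m, n))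
    (X : 'M[C]_m) (Y : 'M[C]_n) : orthonormal_fam Phi ->
  \sum_a hs_sqr (X *m Phi a *m Y) <= hs_sqr X * hs_sqr Y.
Proof.
move=> onP; pose Wt i j : 'M[C]_(m, n) := \matrix_(b, c) (X i b * Y c j)^*%R.
have entry a i j : `|(X *m Phi a *m Y) i j| ^+ 2 =
    `|\tr (adjC_mx (Phi a) *m Wt i j)| ^+ 2.
  rewrite -[in RHS]norm_conjC -mxtrace_adjC adjC_mulmx adjC_mxK hs_dotE.
  congr (`|_| ^+ 2); rewrite mxE exchange_big; apply: eq_bigr => c _ /=.
  rewrite mxE mulr_suml; apply: eq_bigr => b _.
  by rewrite mxE conjCK mulrAC.
apply: (@le_trans _ _ (\sum_i \sum_j hs_sqr (Wt i j))).
  under eq_bigr do rewrite hs_sqrE.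
  rewrite exchange_big /=; apply: ler_sum => i _.
  rewrite exchange_big /=; apply: ler_sum => j _.
  under eq_bigr do rewrite entry.
  exact: bessel.
rewrite le_eqVlt; apply/orP; left; apply/eqP.
rewrite !hs_sqrE mulr_suml; apply: eq_bigr => i _.
rewrite [X in _ = _ * X]exchange_big /= mulr_sumr; apply: eq_bigr => j _.
rewrite hs_sqrE mulr_suml; apply: eq_bigr => b _.
rewrite mulr_sumr; apply: eq_bigr => c _.
by rewrite mxE norm_conjC normrM exprMn.
Qed.

(** Cauchy-Schwarz over [(a, p)] splits off [Z]. The rest is bounded by Bessel's inequality in [p]
    and [orthonormal_sandwich] in [a]. *)
Lemma orthonormal_tau_contractive l m n (Phi : 'I_l -> 'M[C]_(m, n)) :
  orthonormal_fam Phi -> tau_contractive Phi.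
Proof.
move=> onP Z X Y.
rewrite /tau pair_big /=.
pose T a p := \tr (adjC_mx (Phi p) *m X *m Phi a *m Y).
pose f (ap : 'I_l * 'I_l) : R := complex.Re `|Z ap.1 ap.2|.
pose g (ap : 'I_l * 'I_l) : R := complex.Re `|T ap.1 ap.2|.
apply: (@le_trans _ _ (\sum_ap f ap * g ap)%:C).
  apply: norm_sum_le => -[a p] /=.
  by rewrite normrM norm_conjC rmorphM /= -!norm_Re.
rewrite lecR -mulrA; apply: sum_le_mul; rewrite ?mulr_ge0 ?hs_norm_ge0 //.
  rewrite -lecR sum_real_complex hs_norm_sqr hs_sqrE pair_big /=.
  by apply: ler_sum => -[a p] _; rewrite rmorphXn /= -norm_Re.
rewrite -lecR sum_real_complex exprMn rmorphM /= !hs_norm_sqr.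
apply: le_trans (orthonormal_sandwich X Y onP).
rewrite (eq_bigr (fun ap => `|T ap.1 ap.2| ^+ 2)); last first.
  by move=> ap _; rewrite rmorphXn /= -norm_Re.
rewrite -(pair_bigA _ (fun a p => `|T a p| ^+ 2)) /=; apply: ler_sum => a _.
rewrite /T (eq_bigr (fun p => `|\tr (adjC_mx (Phi p) *m (X *m Phi a *m Y))| ^+ 2)).
  exact: bessel.
by move=> p _; rewrite !mulmxA.
Qed.

(** The summands are the blocks of [X] conjugated by the isometry with components [A x]. *)
Lemma hs_sqr_conjugate r m m' (A : 'I_r -> 'M[C]_(m, m')) (X : 'M[C]_m') :
  \sum_x adjC_mx (A x) *m A x = 1%:M ->
  \sum_x \sum_y hs_sqr (A y *m X *m adjC_mx (A x)) = hs_sqr X.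
Proof.
move=> isoA; rewrite /hs_sqr -[in RHS](mulmx1 (adjC_mx X)) -isoA.
rewrite mulmx_sumr mulmx_suml raddf_sum /= exchange_big; apply: eq_bigr => y _ /=.
rewrite (eq_bigr (fun x => \tr (adjC_mx X *m (adjC_mx (A y) *m A y) *m X *m
   (adjC_mx (A x) *m A x)))); last first.
  move=> x _; rewrite !adjC_mulmx adjC_mxK -!mulmxA mxtrace_mulC.
  by rewrite !mulmxA.
by rewrite -raddf_sum -mulmx_sumr isoA mulmx1.
Qed.

(** The form of the new family is a sum of forms of [Phi] over the blocks of the conjugated [X] and
    [Y], whose norms are unchanged. The new family may well have norm above 1; [V_tau] exploits
    exactly this. *)
Lemma tau_contractive_step l r m n m' n' (Phi : 'I_l -> 'M[C]_(m, n))
    (A : 'I_r -> 'M[C]_(m, m')) (B : 'I_r -> 'M[C]_(n, n')) :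
  \sum_x adjC_mx (A x) *m A x = 1%:M -> \sum_x adjC_mx (B x) *m B x = 1%:M ->
  tau_contractive Phi ->
  tau_contractive (fun s => \sum_x adjC_mx (A x) *m Phi s *m B x).
Proof.
move=> isoA isoB cP Z X Y.
pose X' x y := A y *m X *m adjC_mx (A x); pose Y' x y := B x *m Y *m adjC_mx (B y).
have -> : tau (fun s => \sum_x adjC_mx (A x) *m Phi s *m B x) Z X Y =
    \sum_x \sum_y tau Phi Z (X' x y) (Y' x y).
  rewrite /tau.
  under [RHS]eq_bigr do rewrite exchange_big /=.
  rewrite [RHS]exchange_big /=; apply: eq_bigr => a _.
  under [RHS]eq_bigr do rewrite exchange_big /=.
  rewrite [RHS]exchange_big /=; apply: eq_bigr => p _.
  under [RHS]eq_bigr do rewrite -mulr_sumr.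
  rewrite -mulr_sumr; congr (_ * _).
  rewrite mulmx_sumr mulmx_suml raddf_sum /=; apply: eq_bigr => x _.
  rewrite adjC_mx_sum !mulmx_suml raddf_sum /=; apply: eq_bigr => y _.
  rewrite !adjC_mulmx adjC_mxK /X' /Y' -!mulmxA mxtrace_mulC.
  by rewrite !mulmxA.
rewrite pair_big /=.
apply: (@le_trans _ _ (\sum_(xy : 'I_r * 'I_r) hs_norm Z *
  (hs_norm (X' xy.1 xy.2) * hs_norm (Y' xy.1 xy.2)))%:C).
  by apply: norm_sum_le => xy; rewrite mulrA; exact: cP.
rewrite -mulr_sumr lecR -mulrA ler_wpM2l ?hs_norm_ge0 //.
apply: sum_le_mul; rewrite ?hs_norm_ge0 //.
  rewrite -lecR sum_real_complex hs_norm_sqr.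
  rewrite (eq_bigr (fun xy => hs_sqr (X' xy.1 xy.2))) => [|xy _]; last first.
    by rewrite hs_norm_sqr.
  rewrite -(pair_bigA _ (fun x y => hs_sqr (X' x y))) /=.
  by rewrite hs_sqr_conjugate.
rewrite -lecR sum_real_complex hs_norm_sqr.
rewrite (eq_bigr (fun xy => hs_sqr (Y' xy.1 xy.2))) => [|xy _]; last first.
  by rewrite hs_norm_sqr.
rewrite -(pair_bigA _ (fun x y => hs_sqr (Y' x y))) /= exchange_big /=.
by rewrite hs_sqr_conjugate.
Qed.

End Adjoint.

(** * Creation operators *)

Section Creation.
Variables (R : realType) (x : R).
Hypothesis x3 : 3 <= x.
Notation C := R[i].
Notation "[ k ]q" := (bracket x k) (format "[ k ]q").
Variables (d : nat -> nat) (r : nat).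
(* A vector of [H_m (x) H_n] is stored as a matrix [v], so that [X (x) Y] acts as
   [v |-> X v Y^T]; [A k] and [B k] are the components along a basis of [H_1] of
   isometries from [H_k+1] into [H_k (x) H_1] and into [H_1 (x) H_k]. *)
Variables A B Ah Bh : forall k, 'I_r -> 'M[C]_(d k, d k.+1).
Hypothesis A_iso : forall k, \sum_z adjC_mx (A k z) *m A k z = 1%:M.
Hypothesis B_iso : forall k, \sum_z adjC_mx (B k z) *m B k z = 1%:M.
Hypothesis Bh_iso : forall k, \sum_z adjC_mx (Bh k z) *m Bh k z = 1%:M.
Hypothesis A_trace : forall k,
  \sum_z A k z *m adjC_mx (A k z) = ([k.+2]q / [k.+1]q)%:C%:M.
Hypothesis A_wenzl0 : forall y z, A 0 y *m adjC_mx (A 0 z) = (y == z)%:R%:M.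
Hypothesis B_wenzl0 : forall y z, B 0 y *m adjC_mx (B 0 z) = (y == z)%:R%:M.
(** Wenzl's recursion. The left side is a block of the projection onto the copy of [H_k.+2] in
    [H_k.+1 (x) H_1]; the complement is a copy of [H_k], which the adjoints of [Ah] embed without
    normalization. It is absent at level 0. *)
Hypothesis A_wenzlS : forall k y z, A k.+1 y *m adjC_mx (A k.+1 z) =
  (y == z)%:R%:M - ([k.+1]q / [k.+2]q)%:C *: (adjC_mx (Ah k y) *m Ah k z).
Hypothesis B_wenzlS : forall k y z, B k.+1 y *m adjC_mx (B k.+1 z) =
  (y == z)%:R%:M - ([k.+1]q / [k.+2]q)%:C *: (adjC_mx (Bh k y) *m Bh k z).
(** The inserted invariant vector can be absorbed into the operators of either factor; the hats mark
    the opposite choice. *)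
Hypothesis hat_create : forall m n (v : 'M[C]_(d m, d n)),
  \sum_z adjC_mx (Ah m z) *m v *m Bh n z = \sum_z adjC_mx (A m z) *m v *m B n z.
Hypothesis hat_annihilate : forall m n (v : 'M[C]_(d m.+1, d n.+1)),
  \sum_z Ah m z *m v *m adjC_mx (Bh n z) = \sum_z A m z *m v *m adjC_mx (B n z).

Definition create m n (v : 'M[C]_(d m, d n)) : 'M[C]_(d m.+1, d n.+1) :=
  \sum_z adjC_mx (A m z) *m v *m B n z.

Definition annihilate m n (v : 'M[C]_(d m.+1, d n.+1)) : 'M[C]_(d m, d n) :=
  \sum_z A m z *m v *m adjC_mx (B n z).

Lemma createZ m n a (v : 'M[C]_(d m, d n)) : create (a *: v) = a *: create v.
Proof.
by rewrite scaler_sumr; apply: eq_bigr => z _; rewrite -scalemxAr -scalemxAl.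
Qed.

Lemma create_adj m n (u : 'M[C]_(d m, d n)) (v : 'M[C]_(d m.+1, d n.+1)) :
  \tr (adjC_mx (create u) *m v) = \tr (adjC_mx u *m annihilate v).
Proof.
rewrite adjC_mx_sum mulmx_suml mulmx_sumr !raddf_sum /=; apply: eq_bigr => z _.
by rewrite !adjC_mulmx adjC_mxK -!mulmxA mxtrace_mulC !mulmxA.
Qed.

Lemma annihilate_create m n (v : 'M[C]_(d m, d n)) :
  annihilate (create v) =
  \sum_y \sum_z A m y *m adjC_mx (A m z) *m v *m (B n z *m adjC_mx (B n y)).
Proof.
apply: eq_bigr => y _; rewrite mulmx_sumr mulmx_suml; apply: eq_bigr => z _.
by rewrite !mulmxA.
Qed.

Lemma sum_delta_mx m n k (F : 'I_r -> 'I_r -> 'M[C]_(m, n))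
    (G : 'I_r -> 'I_r -> 'M[C]_(n, k)) :
  (forall y z, G y z = 0 \/ y = z) -> \sum_y \sum_z F y z *m G y z =
  \sum_y F y y *m G y y.
Proof.
move=> Gd; apply: eq_bigr => y _; rewrite (bigD1 y) //= big1 ?addr0 // => z zy.
by case: (Gd y z) => [->|E]; rewrite ?mulmx0 //; rewrite E eqxx in zy.
Qed.

Lemma annihilate_create_r0 m (v : 'M[C]_(d m, d 0)) :
  annihilate (create v) = ([m.+2]q / [m.+1]q)%:C *: v.
Proof.
rewrite annihilate_create sum_delta_mx; last first.
  move=> y z; rewrite B_wenzl0; case: eqP => [->|_]; first by right.
  by left; rewrite raddf0.
under eq_bigr do rewrite B_wenzl0 eqxx mulmx1.
by rewrite -mulmx_suml A_trace mul_scalar_mx.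
Qed.

Lemma annihilate_create_rS m n (v : 'M[C]_(d m, d n.+1)) :
  annihilate (create v) = ([m.+2]q / [m.+1]q)%:C *: v -
  ([n.+1]q / [n.+2]q)%:C *: \sum_y \sum_z A m y *m adjC_mx (A m z) *m v *m
    (adjC_mx (Bh n z) *m Bh n y).
Proof.
rewrite annihilate_create.
under eq_bigr => y _ do under eq_bigr => z _ do rewrite B_wenzlS mulmxBr.
under eq_bigr => y _ do rewrite sumrB.
rewrite sumrB; congr (_ - _).
  rewrite sum_delta_mx; last first.
    by move=> y z; case: eqP => [->|_]; [right | left; rewrite raddf0].
  under eq_bigr do rewrite eqxx mulmx1.
  by rewrite -mulmx_suml A_trace mul_scalar_mx.
rewrite scaler_sumr; apply: eq_bigr => y _; rewrite scaler_sumr.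
by apply: eq_bigr => z _; rewrite -scalemxAr.
Qed.

Lemma annihilate_create_0S n (v : 'M[C]_(d 0, d n.+1)) :
  annihilate (create v) = ([2]q / [1]q - [n.+1]q / [n.+2]q)%:C *: v.
Proof.
rewrite annihilate_create_rS rmorphB scalerBl; congr (_ - _ *: _).
under eq_bigr => y _ do under eq_bigr => z _ do rewrite A_wenzl0.
rewrite (eq_bigr (fun y => v *m (adjC_mx (Bh n y) *m Bh n y))).
  by rewrite -mulmx_sumr Bh_iso mulmx1.
move=> y _; rewrite (bigD1 y) //= eqxx mul1mx big1 ?addr0 // => z /negbTE zy.
by rewrite eq_sym zy raddf0 !mul0mx.
Qed.

(** Both factors are expanded by Wenzl's recursion. The product of the two corrections is [create]
    after [annihilate] in hatted form, and the hats are removed by [hat_create] and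
    [hat_annihilate]. *)
Lemma annihilate_create_SS m n (v : 'M[C]_(d m.+1, d n.+1)) :
  annihilate (create v) =
  ([m.+3]q / [m.+2]q - [n.+1]q / [n.+2]q)%:C *: v +
  ([m.+1]q * [n.+1]q / ([m.+2]q * [n.+2]q))%:C *: create (annihilate v).
Proof.
rewrite annihilate_create_rS rmorphB scalerBl -addrA; congr (_ + _).
rewrite (_ : \sum_y _ = v - ([m.+1]q / [m.+2]q)%:C *: create (annihilate v)).
  rewrite scalerBr opprB addrC scalerA -rmorphM; congr (_ + _).
  by congr (_%:C *: _); rewrite invfM; ring.
transitivity (\sum_y \sum_z ((y == z)%:R *: v *m (adjC_mx (Bh n z) *m Bh n y) -
  ([m.+1]q / [m.+2]q)%:C *:
  (adjC_mx (Ah m y) *m (Ah m z *m v *m adjC_mx (Bh n z)) *m Bh n y))).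
  apply: eq_bigr => y _; apply: eq_bigr => z _.
  rewrite A_wenzlS !mulmxBl mul_scalar_mx; congr (_ - _).
  by rewrite -!scalemxAl !mulmxA.
under eq_bigr => y _ do rewrite sumrB.
rewrite sumrB; congr (_ - _).
  rewrite (eq_bigr (fun y => v *m (adjC_mx (Bh n y) *m Bh n y))).
    by rewrite -mulmx_sumr Bh_iso mulmx1.
  move=> y _; rewrite (bigD1 y) //= eqxx scale1r big1 ?addr0 // => z /negbTE zy.
  by rewrite eq_sym zy scale0r !mul0mx.
rewrite /create -hat_create scaler_sumr; apply: eq_bigr => y _.
by rewrite -scaler_sumr /annihilate -hat_annihilate mulmx_sumr mulmx_suml.
Qed.

(** Nothing can be annihilated when one of the factors is [H_0], so no condition is imposed
    there. *)
Definition vacuum b c : 'M[C]_(d b, d c) -> Prop :=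
  match b, c with
  | b'.+1, c'.+1 => fun v => annihilate v = 0
  | _, _ => fun=> True
  end.

Variables (b c l : nat) (Phi0 : 'I_l -> 'M[C]_(d b, d c)).
Hypothesis Phi0_on : orthonormal_fam Phi0.
Hypothesis Phi0_vacuum : forall s, vacuum (Phi0 s).

Fixpoint tower a : 'I_l -> 'M[C]_(d (a + b), d (a + c)) :=
  match a with
  | 0 => Phi0
  | a'.+1 => fun s => create (tower a' s)
  end.

Lemma annihilate_tower a s :
  annihilate (tower a.+1 s) = (nu x a b c)%:C *: tower a s.
Proof.
elim: a => [|a IH]; last first.
  apply: etrans (@annihilate_create_SS (a + b) (a + c) (tower a.+1 s)) _.
  rewrite IH createZ scalerA -scalerDl -rmorphM -rmorphD.
  by rewrite nuS.
rewrite nu0 //=; have := Phi0_vacuum s; move: (Phi0 s) => v.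
case: b c v => [|b'] [|c'] v /= vac.
- by rewrite annihilate_create_r0 bracket0 mul0r subr0.
- by rewrite annihilate_create_0S.
- by rewrite annihilate_create_r0 bracket0 mul0r subr0.
- rewrite annihilate_create_SS vac.
  by rewrite -(scale0r (0 : 'M_(d b', d c'))) createZ scale0r scaler0 addr0.
Qed.

Lemma tower_gram a s t :
  \tr (adjC_mx (tower a s) *m tower a t) = (s == t)%:R * (mu x a b c)%:C.
Proof.
elim: a => [|a IH]; first by rewrite Phi0_on mulr1.
rewrite [X in _ *m X]/= [X in adjC_mx X]/= create_adj.
rewrite -[create _]/(tower a.+1 t) annihilate_tower -scalemxAr mxtraceZ IH /=.
by rewrite [in RHS]rmorphM /= mulrCA.
Qed.

Lemma tower_contractive a : tau_contractive (tower a).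
Proof.
elim: a => [|a IH]; first exact: orthonormal_tau_contractive.
exact: (tau_contractive_step (A_iso _) (B_iso _) IH).
Qed.

End Creation.

(** * Intertwiners *)

Section StarMatrices.
Variables (R : realType) (A : cstarAlg R).
Notation C := R[i].

Lemma star0 : star (0 : A) = 0.
Proof. by have := starZ 0 (0 : A); rewrite conjC0 !scale0r. Qed.

Lemma star1 : star (1 : A) = 1.
Proof. by have := starM (star (1 : A)) 1; rewrite starK !mulr1 starK. Qed.

Lemma star_sum (I : finType) (F : I -> A) : star (\sum_i F i) = \sum_i star (F i).
Proof. exact: (big_morph _ (@starD R A) star0). Qed.

Lemma scal_mxM m n p (M : 'M[C]_(m, n)) (M' : 'M[C]_(n, p)) :
  scal_mx A (M *m M') = scal_mx A M *m scal_mx A M'.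
Proof. exact: (map_mxM (GRing.in_alg A)). Qed.

Lemma scal_mxB m n (M M' : 'M[C]_(m, n)) :
  scal_mx A (M - M') = scal_mx A M - scal_mx A M'.
Proof. exact: (map_mxB (GRing.in_alg A)). Qed.

Lemma scal_mx_scalar n (c : C) : scal_mx A (c%:M : 'M_n) = (c%:A)%:M.
Proof. exact: (map_scalar_mx (GRing.in_alg A)). Qed.

Lemma scal_mx1 n : scal_mx A (1%:M : 'M_n) = 1%:M.
Proof. by rewrite scal_mx_scalar scale1r. Qed.

Lemma scal_mx0 m n : scal_mx A (0 : 'M_(m, n)) = 0.
Proof. exact: (map_mx0 (GRing.in_alg A)). Qed.

Lemma scal_mulmxE m n p (M : 'M[C]_(m, n)) (v : 'M[A]_(n, p)) i j :
  (scal_mx A M *m v) i j = \sum_k M i k *: v k j.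
Proof. by rewrite mxE; apply: eq_bigr => k _; rewrite mxE mulr_algl. Qed.

Lemma mul_scal_mxE m n p (v : 'M[A]_(m, n)) (M : 'M[C]_(n, p)) i j :
  (v *m scal_mx A M) i j = \sum_k M k j *: v i k.
Proof. by rewrite mxE; apply: eq_bigr => k _; rewrite mxE mulr_algr. Qed.

Lemma adj_mxE m n (v : 'M[A]_(m, n)) i j : adj_mx v i j = star (v j i).
Proof. by rewrite !mxE. Qed.

Lemma adj_mxM m n p (v : 'M[A]_(m, n)) (v' : 'M[A]_(n, p)) :
  adj_mx (v *m v') = adj_mx v' *m adj_mx v.
Proof.
apply/matrixP => i j; rewrite adj_mxE !mxE star_sum.
by apply: eq_bigr => k _; rewrite starM !adj_mxE.
Qed.

Lemma adj_scal_mx m n (M : 'M[C]_(m, n)) :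
  adj_mx (scal_mx A M) = scal_mx A (adjC_mx M).
Proof. by apply/matrixP => i j; rewrite !mxE starZ star1. Qed.

Lemma intertwiner_adj m n (v : 'M[A]_m) (v' : 'M[A]_n) (M : 'M[C]_(m, n)) :
  unitary_mx v -> unitary_mx v' -> v *m scal_mx A M = scal_mx A M *m v' ->
  v' *m scal_mx A (adjC_mx M) = scal_mx A (adjC_mx M) *m v.
Proof.
move=> [_ vv] [v'v' _] /(congr1 (@adj_mx R A _ _)).
rewrite !adj_mxM adj_scal_mx => E.
rewrite -[X in X *m v]mul1mx -v'v' -(mulmxA v') -E.
by rewrite -!mulmxA vv mulmx1.
Qed.

Lemma schur_scalar n (v : 'M[A]_n) (M : 'M[C]_n) : irreducible_rep v ->
  v *m scal_mx A M = scal_mx A M *m v -> exists c, M = c%:M.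
Proof.
move=> [n0 irr] vM.
have /closed_rootP[a] : size (char_poly M) != 1 by rewrite size_char_poly eqSS -lt0n.
rewrite -eigenvalue_root_char => /eigenvalueP[r rM r0].
(* [e] projects onto the kernel of [M - a], which is a nonzero invariant subspace. *)
pose M' := M - a%:M; pose e := 1%:M - pinvmx M' *m M'.
have vM' : v *m scal_mx A M' = scal_mx A M' *m v.
  rewrite scal_mxB mulmxBr mulmxBl vM; congr (_ - _).
  apply/matrixP => i j; rewrite scal_mulmxE mul_scal_mxE.
  rewrite (bigD1 j) //= (bigD1 (P := xpredT) i) //= !mxE !eqxx.
  by rewrite !big1 // => k /negbTE ki; rewrite !mxE ?ki ?(eq_sym i) ?ki scale0r.
have M'e : M' *m e = 0 by rewrite mulmxBr mulmx1 mulmxA mulmxKpV ?subrr.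
have ee : e *m e = e by rewrite {1}/e mulmxBl mul1mx -mulmxA M'e mulmx0 subr0.
have ve : v *m scal_mx A e = scal_mx A e *m v *m scal_mx A e.
  have eE : scal_mx A e = 1%:M - scal_mx A (pinvmx M') *m scal_mx A M'.
    by rewrite scal_mxB scal_mx1 scal_mxM.
  rewrite [X in _ = X *m _ *m _]eE !mulmxBl mul1mx -[LHS]subr0; congr (_ - _).
  by rewrite -(mulmxA _ _ v) -vM' -!mulmxA -scal_mxM M'e scal_mx0 !mulmx0.
have [e0|e1] := irr _ ee ve.
  have rM' : r *m M' = 0 by rewrite mulmxBr rM mul_mx_scalar subrr.
  case/negP: r0; apply/eqP; move/eqP: e0; rewrite subr_eq0 => /eqP e0.
  have : M' *m pinvmx M' = 1%:M by apply: mulmx1C; rewrite -e0.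
  by move=> h; rewrite -[r]mulmx1 -h mulmxA rM' mul0mx.
by exists a; apply/eqP; rewrite -subr_eq0 -/M' -[M']mulmx1 -e1 M'e.
Qed.

(** [M^* M] and [M M^*] are intertwiners, hence scalars, and they coincide because [M != 0]. Their
    common value [c] is positive by a trace, and [M / sqrt c] is unitary. *)
Lemma schur_equiv m n (v : 'M[A]_m) (v' : 'M[A]_n) (M : 'M[C]_(m, n)) :
  unitary_mx v -> unitary_mx v' -> irreducible_rep v -> irreducible_rep v' ->
  v *m scal_mx A M = scal_mx A M *m v' -> M != 0 -> rep_equiv v v'.
Proof.
move=> uv uv' iv iv' vM M0; have vM' := intertwiner_adj uv uv' vM.
have [c cE] : exists c, adjC_mx M *m M = c%:M.
  by apply: (schur_scalar iv'); rewrite scal_mxM mulmxA vM' -!mulmxA vM.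
have [c' c'E] : exists c, M *m adjC_mx M = c%:M.
  by apply: (schur_scalar iv); rewrite scal_mxM mulmxA vM -!mulmxA vM'.
have cc' : c = c'.
  apply/eqP; rewrite -subr_eq0; apply/negPn/negP => cc0; case/negP: M0.
  have : (c - c') *: M = 0.
    by rewrite scalerBl -mul_mx_scalar -mul_scalar_mx -cE -c'E mulmxA subrr.
  by move/eqP; rewrite scaler_eq0 (negbTE cc0).
have n0 : n%:R != 0 :> C by rewrite pnatr_eq0 -lt0n; case: iv'.
have trc : hs_sqr M = n%:R * c by rewrite /hs_sqr cE mxtrace_scalar mulr_natl.
have c0 : 0 < c.
  have c_ge0 : 0 <= c.
    have := hs_sqr_ge0 M; rewrite trc pmulr_rge0 // lt0r n0 ler0n //.
  rewrite lt0r c_ge0 andbT; apply/negP => /eqP c0; case/negP: M0.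
  by apply/eqP/hs_sqr_eq0; rewrite trc c0 mulr0.
pose k := (sqrtC c)^-1.
have kk : k * k^*%R = c^-1.
  rewrite conj_Creal ?rpredV ?ger0_real ?sqrtC_ge0 ?ltW //.
  by rewrite /k -invfM -expr2 sqrtCK.
exists (k *: M); split.
- rewrite adjC_mxZ -scalemxAl -scalemxAr scalerA c'E -cc' kk.
  by rewrite scale_scalar_mx mulVf // gt_eqF.
- rewrite adjC_mxZ -scalemxAl -scalemxAr scalerA cE mulrC kk.
  by rewrite scale_scalar_mx mulVf // gt_eqF.
- apply/matrixP => i j; move/matrixP/(_ i j): vM.
  rewrite !mul_scal_mxE !scal_mulmxE => /(congr1 (fun z => k *: z)).
  rewrite !scaler_sumr => E.
  transitivity (\sum_l k *: (M l j *: v i l)).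
    by apply: eq_bigr => l _; rewrite mxE scalerA.
  by rewrite E; apply: eq_bigr => l _; rewrite mxE scalerA.
Qed.

Lemma rep_equiv_dim m n (v : 'M[A]_m) (v' : 'M[A]_n) : rep_equiv v v' -> m = n.
Proof.
move=> [S [S1 S2 _]]; apply/eqP; rewrite eqn_leq.
have h p q (X : 'M[C]_(p, q)) (Y : 'M[C]_(q, p)) : X *m Y = 1%:M -> (p <= q)%N.
  move=> XY; rewrite -(mxrank1 C p) -XY (leq_trans (mxrankM_maxl _ _)) //.
  exact: rank_leq_col.
by rewrite (h _ _ _ _ S1) (h _ _ _ _ S2).
Qed.

End StarMatrices.

(** * Haar state and fusion rules *)

Section HaarOrthogonality.
Variables (R : realType) (A T : cstarAlg R) (i1 i2 Delta : {lrmorphism A -> T}).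
Variable h : {scalar A}.
Hypothesis tensorT : cstar_tensor i1 i2.
Hypothesis starDelta : star_preserving Delta.
Hypothesis hh : haar_state i1 i2 Delta h.
Notation C := R[i].

(** [P] is the Haar average of [v^* E v'] for the matrix unit [E] at [(a, b)]; invariance of [h]
    gives [v^* P v' = P]. *)
Lemma haar_intertwiner m n (v : 'M[A]_m) (v' : 'M[A]_n) a b :
  unitary_rep i1 i2 Delta v -> comult_mx i1 i2 Delta v' ->
  let P := \matrix_(p, t) h (star (v a p) * v' b t) in
  v *m scal_mx A P = scal_mx A P *m v'.
Proof.
case: tensorT => star1 star2 comm12 _ [[uv _] cv] cv' P.
have [_ _ [s [_ s12 sD]] _] := hh.
(* Apply the slice map to the coproduct of [star (v a p) * v' b t]. *)
suff E : adj_mx v *m (scal_mx A P *m v') = scal_mx A P.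
  by rewrite -{1}E !mulmxA uv mul1mx.
apply/matrixP => p t; rewrite !mxE -sD rmorphM /= starDelta cv cv' star_sum.
rewrite mulr_suml raddf_sum; apply: eq_bigr => k _ /=.
rewrite scal_mulmxE mulr_sumr mulr_sumr raddf_sum; apply: eq_bigr => q _ /=.
rewrite starM -star1 -star2 -comm12 mulrA -(mulrA (i1 _)) -comm12 mulrA.
by rewrite -rmorphM -mulrA -rmorphM s12 !mxE scalerAr.
Qed.

Lemma haar_orth_neq m n (v : 'M[A]_m) (v' : 'M[A]_n) a b p t :
  unitary_rep i1 i2 Delta v -> unitary_rep i1 i2 Delta v' ->
  irreducible_rep v -> irreducible_rep v' -> ~ rep_equiv v v' ->
  h (star (v a p) * v' b t) = 0.
Proof.
move=> rv rv' iv iv' nvv'.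
have := haar_intertwiner a b rv rv'.2; set P := (\matrix_(_, _) _) => vP.
have [P0|P0] := eqVneq P 0; last first.
  by case: nvv'; exact: schur_equiv rv.1 rv'.1 iv iv' vP P0.
by have := congr1 (fun M : 'M_(m, n) => M p t) P0; rewrite !mxE.
Qed.

(* For a compact quantum group of Kac type, the conjugate of a unitary
   representation is again unitary. *)
Definition kac_mx n (v : 'M[A]_n) :=
  forall a b, \sum_k star (v a k) * v b k = (a == b)%:R.

(** By Schur's lemma the averaged matrix is a scalar, and [kac_mx] computes its trace. *)
Lemma haar_orth n (v : 'M[A]_n) a b p t :
  unitary_rep i1 i2 Delta v -> irreducible_rep v -> kac_mx v ->
  h (star (v a p) * v b t) = (a == b)%:R * (p == t)%:R / n%:R.
Proof.
move=> rv iv kv; have [h1 _ _ _] := hh.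
have := haar_intertwiner a b rv rv.2; set P := (\matrix_(_, _) _) => vP.
have [c Pc] := schur_scalar iv vP.
have n0 : n%:R != 0 :> C by rewrite pnatr_eq0 -lt0n; case: iv.
have trP : n%:R * c = (a == b)%:R.
  rewrite mulr_natl -mxtrace_scalar -Pc /mxtrace.
  under eq_bigr do rewrite mxE.
  rewrite -raddf_sum kv; case: eqP => _; first exact: h1.
  exact: linear0.
have -> : h (star (v a p) * v b t) = P p t by rewrite mxE.
by rewrite Pc mxE -trP mulrAC -mulr_natr; field.
Qed.

End HaarOrthogonality.

Section Fusion.
Variables (R : realType) (A : cstarAlg R).
Variables (d : nat -> nat) (w : forall k, 'M[A]_(d k)).
Notation C := R[i].

Lemma sum_mxtens_index (V : nmodType) m n (F : 'I_(m * n) -> V) :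
  \sum_k F k = \sum_p \sum_q F (mxtens_index (p, q)).
Proof.
rewrite pair_big /= (reindex (@mxtens_index m n)) /=.
  by apply: eq_bigr => -[p q].
exists (@mxtens_unindex m n) => k _.
  exact: mxtens_indexK.
exact: mxtens_unindexK.
Qed.

(** The relation [(w_i (x) w_j) Phi = Phi w_l], where [Phi] is given by its values on a basis of
    [H_l]. *)
Definition is_hom i j l (Phi : 'I_(d l) -> 'M[C]_(d i, d j)) :=
  forall p q s, \sum_p' \sum_q' Phi s p' q' *: (w i p p' * w j q q') =
    \sum_t Phi t p q *: w l t s.

(** The adjoint relation [Phi^* (w_i (x) w_j) = w_l Phi^*]. *)
Definition is_cohom i j l (Phi : 'I_(d l) -> 'M[C]_(d i, d j)) :=
  forall p q s, \sum_p' \sum_q' (Phi s p' q')^*%R *: (w i p' p * w j q' q) =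
    \sum_t (Phi t p q)^*%R *: w l s t.

Definition fusion_index i j t := (maxn i j - minn i j + t.*2)%N.

(** The [U t] are the column blocks of the unitary [S]. One half of unitarity gives orthonormality
    within a block, the other half completeness over all blocks. *)
Lemma fusion_blocks i j : rep_equiv (w i *t w j) (fusion_sum w i j) ->
  exists U : forall t : 'I_(minn i j).+1,
      'I_(d (fusion_index i j t)) -> 'M[C]_(d i, d j),
    [/\ forall t, is_hom (U t), forall t, is_cohom (U t),
        forall t, orthonormal_fam (U t) &
        forall p q p' q', \sum_t \sum_s U t s p q * (U t s p' q')^*%R =
          (p == p')%:R * (q == q')%:R].
Proof.
case=> S [SS' S'S vS].
have E (t : 'I_(minn i j).+1) :
    (w i *t w j) *m scal_mx A (submxrow S t) =
    scal_mx A (submxrow S t) *m w (fusion_index i j t).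
  have scS k (M : 'M_(k, _)) : scal_mx A (submxrow M t) = submxrow (scal_mx A M) t.
    by rewrite /submxrow /scal_mx map_mxsub.
  rewrite scS mul_submxrow vS -[scal_mx A S]submxrowK mul_mxrow_mxdiag.
  by rewrite !mxrowK.
have S'v : scal_mx A (adjC_mx S) *m (w i *t w j) =
    fusion_sum w i j *m scal_mx A (adjC_mx S).
  rewrite -[LHS]mulmx1 -(scal_mx1 A) -SS' scal_mxM mulmxA -(mulmxA _ (_ *t _)) vS.
  by rewrite mulmxA -scal_mxM S'S scal_mx1 mul1mx.
have adjS t : adjC_mx (submxrow S t) = submxcol (adjC_mx S) t.
  by apply/matrixP => x y; rewrite !mxE.
have E' (t : 'I_(minn i j).+1) :
    scal_mx A (adjC_mx (submxrow S t)) *m (w i *t w j) =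
    w (fusion_index i j t) *m scal_mx A (adjC_mx (submxrow S t)).
  have scS k (M : 'M_(_, k)) : scal_mx A (submxcol M t) = submxcol (scal_mx A M) t.
    by rewrite /submxcol /scal_mx map_mxsub.
  rewrite adjS scS submxcol_mul S'v -[scal_mx A (adjC_mx S)]submxcolK.
  by rewrite mul_mxdiag_mxcol !mxcolK.
exists (fun t s => \matrix_(p, q) submxrow S t (mxtens_index (p, q)) s); split.
- move=> t p q s.
  have := congr1 (fun M : 'M_(_, _) => M (mxtens_index (p, q)) s) (E t).
  rewrite /= mul_scal_mxE scal_mulmxE sum_mxtens_index => E1.
  transitivity (\sum_p' \sum_q' submxrow S t (mxtens_index (p', q')) s *:
      (w i *t w j) (mxtens_index (p, q)) (mxtens_index (p', q'))).
    apply: eq_bigr => p' _; apply: eq_bigr => q' _.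
    by rewrite tensmxE [X in X *: _]mxE.
  by rewrite E1; apply: eq_bigr => t' _; rewrite [in RHS]mxE.
- move=> t p q s.
  have := congr1 (fun M : 'M_(_, _) => M s (mxtens_index (p, q))) (E' t).
  rewrite /= mul_scal_mxE scal_mulmxE sum_mxtens_index => E1.
  transitivity (\sum_p' \sum_q' adjC_mx (submxrow S t) s (mxtens_index (p', q')) *:
      (w i *t w j) (mxtens_index (p', q')) (mxtens_index (p, q))).
    apply: eq_bigr => p' _; apply: eq_bigr => q' _.
    by rewrite tensmxE adjC_mxE mxE.
  by rewrite E1; apply: eq_bigr => t' _; rewrite adjC_mxE mxE.
- move=> t s s'; rewrite hs_dotE.
  have : adjC_mx (submxrow S t) *m submxrow S t = 1%:M.
    rewrite adjS mul_submxrow submxcol_mul.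
    rewrite S'S -submxblockEv.
    by rewrite -mxdiagZ submxblock_diag.
  move=> /(congr1 (fun M : 'M_(_, _) => M s s')) /=; rewrite !mxE => <-.
  rewrite sum_mxtens_index; apply: eq_bigr => p _; apply: eq_bigr => q _.
  by rewrite !mxE.
- move=> p q p' q'.
  have := congr1 (fun M : 'M_(_, _) => M (mxtens_index (p, q)) (mxtens_index (p', q'))) SS'.
  rewrite /= [in RHS]mxE (can_eq (@mxtens_indexK _ _)) xpair_eqE -mulnb natrM => <-.
  rewrite -[X in (X *m _) _ _]submxrowK -[X in (_ *m X) _ _]submxcolK.
  rewrite mul_mxrow_mxcol summxE.
  apply: eq_bigr => t _; rewrite mxE; apply: eq_bigr => s _.
  by rewrite !mxE.
Qed.

End Fusion.

(** * The category of representations *)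

Section Category.
Variables (R : realType) (A : cstarAlg R).
Variables (d : nat -> nat) (w : forall k, 'M[A]_(d k)).
Notation C := R[i].
Variable U : forall i j (t : 'I_(minn i j).+1),
  'I_(d (fusion_index i j t)) -> 'M[C]_(d i, d j).
Hypothesis U_hom : forall i j t, is_hom w (@U i j t).
Hypothesis U_cohom : forall i j t, is_cohom w (@U i j t).
Hypothesis U_on : forall i j t, orthonormal_fam (@U i j t).
Hypothesis U_complete : forall i j p q p' q',
  \sum_(t < (minn i j).+1) \sum_s @U i j t s p q * (@U i j t s p' q')^*%R =
  (p == p')%:R * (q == q')%:R.
Hypothesis schur_neq : forall l e (P : 'M[C]_(d l, d e)), l <> e ->
  w l *m scal_mx A P = scal_mx A P *m w e -> P = 0.
Hypothesis schur_eq : forall l (P : 'M[C]_(d l)),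
  w l *m scal_mx A P = scal_mx A P *m w l -> exists c, P = c%:M.

Definition fusion_ok i j l := [exists t : 'I_(minn i j).+1, fusion_index i j t == l].

(* Comparing the indices as natural numbers transports [U] along
   [fusion_index i j t = l] without a cast. *)
Definition V i j l (s : 'I_(d l)) : 'M[C]_(d i, d j) :=
  \sum_(t < (minn i j).+1) \sum_(s' < d (fusion_index i j t))
    if (fusion_index i j t == l) && (s' == s :> nat) then U s' else 0.

Lemma V_index i j (t : 'I_(minn i j).+1) (s : 'I_(d (fusion_index i j t))) :
  V i j s = @U i j t s.
Proof.
rewrite /V (bigD1 t) //= [X in _ + X]big1 ?addr0 => [|t' t't]; last first.
  rewrite big1 // => s' _; rewrite ifF //; apply/negbTE; move: t't.
  by apply: contra => /andP[+ _]; rewrite -val_eqE /fusion_index /=; lia.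
rewrite (bigD1 s) //= !eqxx big1 ?addr0 // => s' /negbTE s's.
by rewrite val_eqE s's andbF.
Qed.

Lemma V_eq0 i j l s : ~~ fusion_ok i j l -> V i j (l := l) s = 0.
Proof.
move=> /existsPn nok; rewrite /V big1 // => t _; rewrite big1 // => s' _.
by rewrite (negbTE (nok t)).
Qed.

Lemma V_hom i j l : is_hom w (V i j (l := l)).
Proof.
have [/existsP[t /eqP <-] p q s|nok p q s] := boolP (fusion_ok i j l).
  under eq_bigr do under eq_bigr do rewrite V_index.
  by under [RHS]eq_bigr do rewrite V_index; exact: U_hom.
rewrite !big1 // => [t _|p' _]; first by rewrite V_eq0 // mxE scale0r.
by rewrite big1 // => q' _; rewrite V_eq0 // mxE scale0r.
Qed.

Lemma V_cohom i j l : is_cohom w (V i j (l := l)).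
Proof.
have [/existsP[t /eqP <-] p q s|nok p q s] := boolP (fusion_ok i j l).
  under eq_bigr do under eq_bigr do rewrite V_index.
  by under [RHS]eq_bigr do rewrite V_index; exact: U_cohom.
rewrite !big1 // => [t _|p' _]; first by rewrite V_eq0 // mxE rmorph0 scale0r.
by rewrite big1 // => q' _; rewrite V_eq0 // mxE rmorph0 scale0r.
Qed.

Lemma V_on i j l : fusion_ok i j l -> orthonormal_fam (V i j (l := l)).
Proof. by move=> /existsP[t /eqP <-] s s'; rewrite !V_index U_on. Qed.

Lemma V_complete i j p q p' q' :
  \sum_(t < (minn i j).+1) \sum_(s < d (fusion_index i j t))
    V i j s p q * (V i j s p' q')^*%R = (p == p')%:R * (q == q')%:R.
Proof.
rewrite -U_complete; apply: eq_bigr => t _; apply: eq_bigr => s _.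
by rewrite !V_index.
Qed.

Lemma V_expand i j (M : 'M[C]_(d i, d j)) :
  M = \sum_(t < (minn i j).+1) \sum_(s < d (fusion_index i j t))
    \tr (adjC_mx (V i j s) *m M) *: V i j s.
Proof.
apply/matrixP => p q; rewrite summxE.
transitivity (\sum_p' \sum_q' M p' q' * ((p == p')%:R * (q == q')%:R)).
  rewrite (bigD1 p) //= (bigD1 q) //= !eqxx !mulr1 !big1 ?addr0 // => [p'|q'].
    by move=> /negbTE pp; rewrite big1 // => q' _; rewrite eq_sym pp mul0r mulr0.
  by move=> /negbTE qq; rewrite (eq_sym q) qq mulr0 mulr0.
under eq_bigr => p' _ do under eq_bigr => q' _ do rewrite -V_complete mulr_sumr.
under eq_bigr => p' _ do rewrite exchange_big /=.
rewrite exchange_big /=; apply: eq_bigr => t _.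
under eq_bigr => p' _ do under eq_bigr => q' _ do rewrite mulr_sumr.
under eq_bigr => p' _ do rewrite exchange_big /=.
rewrite exchange_big summxE /=; apply: eq_bigr => s _.
rewrite mxE hs_dotE mulr_suml; apply: eq_bigr => p' _.
by rewrite mulr_suml; apply: eq_bigr => q' _; ring.
Qed.

(** [P] is the matrix of [V^* Phi], a composition of intertwiners; Schur's lemma applied to it
    yields [hom_orth] and [hom_unique]. *)
Lemma gram_intertwiner i j l e (Phi : 'I_(d e) -> 'M[C]_(d i, d j)) :
  is_hom w Phi ->
  let P := \matrix_(s, t) \tr (adjC_mx (V i j (l := l) s) *m Phi t) in
  w l *m scal_mx A P = scal_mx A P *m w e.
Proof.
move=> hPhi P; apply/matrixP => s t; rewrite mul_scal_mxE scal_mulmxE.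
transitivity (\sum_p \sum_q Phi t p q *: \sum_r (V i j r p q)^*%R *: w l s r).
  under [RHS]eq_bigr => p _ do under eq_bigr => q _ do rewrite scaler_sumr.
  under [RHS]eq_bigr => p _ do rewrite exchange_big /=.
  rewrite [RHS]exchange_big; apply: eq_bigr => r _ /=.
  rewrite mxE hs_dotE scaler_suml; apply: eq_bigr => p _.
  by rewrite scaler_suml; apply: eq_bigr => q _; rewrite scalerA mulrC.
transitivity (\sum_p \sum_q (V i j s p q)^*%R *: \sum_r Phi r p q *: w e r t).
  under eq_bigr => p _ do under eq_bigr => q _ do rewrite -V_cohom scaler_sumr.
  under [RHS]eq_bigr => p _ do under eq_bigr => q _ do rewrite -hPhi scaler_sumr.
  under eq_bigr => p _ do under eq_bigr => q _ do under eq_bigr => p' _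
    do rewrite scaler_sumr.
  under [RHS]eq_bigr => p _ do under eq_bigr => q _ do under eq_bigr => p' _
    do rewrite scaler_sumr.
  rewrite [LHS]pair_bigA [RHS]pair_bigA /=.
  under eq_bigr => pq _ do rewrite pair_bigA /=.
  under [RHS]eq_bigr => pq _ do rewrite pair_bigA /=.
  rewrite exchange_big; apply: eq_bigr => -[p q] _; apply: eq_bigr => -[p' q'] _ /=.
  by rewrite !scalerA mulrC.
under eq_bigr => p _ do under eq_bigr => q _ do rewrite scaler_sumr.
under eq_bigr => p _ do rewrite exchange_big /=.
rewrite exchange_big; apply: eq_bigr => r _ /=.
rewrite mxE hs_dotE scaler_suml; apply: eq_bigr => p _.
by rewrite scaler_suml; apply: eq_bigr => q _; rewrite scalerA.
Qed.

Lemma hom_orth i j l e (Phi : 'I_(d e) -> 'M[C]_(d i, d j)) s t :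
  is_hom w Phi -> l <> e -> \tr (adjC_mx (V i j (l := l) s) *m Phi t) = 0.
Proof.
move=> hPhi le; have := schur_neq le (gram_intertwiner l hPhi).
by move=> /matrixP/(_ s t); rewrite !mxE.
Qed.

Lemma hom_unique i j l (Phi : 'I_(d l) -> 'M[C]_(d i, d j)) :
  is_hom w Phi -> exists c, forall s, Phi s = c *: V i j s.
Proof.
move=> hPhi; have [c cE] := schur_eq (gram_intertwiner l hPhi).
exists c => s; rewrite {1}[Phi s]V_expand.
have [/existsP[t /eqP tl]|nok] := boolP (fusion_ok i j l); last first.
  rewrite V_eq0 // scaler0 big1 // => t _; rewrite big1 // => s' _.
  rewrite hom_orth ?scale0r // => tl.
  by move/existsPn: nok => /(_ t); rewrite tl eqxx.
subst l; rewrite (bigD1 t) //= [X in _ + X]big1 ?addr0 => [|t' t't]; last first.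
  rewrite big1 // => s' _; rewrite hom_orth ?scale0r //.
  by move=> E; case/eqP: t't; apply: val_inj; move: E; rewrite /fusion_index /=; lia.
rewrite (bigD1 s) //= big1 => [|s' /negbTE s's].
  by have /matrixP/(_ s s) := cE; rewrite !mxE eqxx mulr1n addr0 => ->.
by have /matrixP/(_ s' s) := cE; rewrite !mxE s's mulr0n => ->; rewrite scale0r.
Qed.

Lemma coef_mul i j b q c r : w i b q * w j c r =
  \sum_(t < (minn i j).+1) \sum_(s < d (fusion_index i j t))
    \sum_(s' < d (fusion_index i j t))
      (V i j s b c * (V i j s' q r)^*%R) *: w (fusion_index i j t) s s'.
Proof.
transitivity (\sum_q' \sum_r' ((q == q')%:R * (r == r')%:R) *:
    (w i b q' * w j c r')).
  rewrite (bigD1 q) //= (bigD1 r) //= !eqxx mulr1 scale1r !big1 ?addr0 // => [q'|r'].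
    move=> /negbTE qq; rewrite big1 // => r' _.
    by rewrite eq_sym qq mul0r scale0r.
  by move=> /negbTE rr; rewrite (eq_sym r) rr mulr0 scale0r.
under eq_bigr => q' _ do under eq_bigr => r' _ do
  rewrite (eq_sym q) (eq_sym r) -V_complete scaler_suml.
under eq_bigr => q' _ do rewrite exchange_big /=.
rewrite exchange_big /=; apply: eq_bigr => t _.
under eq_bigr => q' _ do under eq_bigr => r' _ do rewrite scaler_suml.
under eq_bigr => q' _ do rewrite exchange_big /=.
rewrite exchange_big [RHS]exchange_big /=; apply: eq_bigr => s' _.
transitivity ((V i j s' q r)^*%R *: \sum_q' \sum_r' V i j s' q' r' *:
    (w i b q' * w j c r')).
  rewrite scaler_sumr; apply: eq_bigr => q' _; rewrite scaler_sumr.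
  by apply: eq_bigr => r' _; rewrite scalerA mulrC.
rewrite V_hom scaler_sumr; apply: eq_bigr => s _.
by rewrite scalerA mulrC.
Qed.

Lemma fusion_okP i j l : reflect
  (exists a b c, [/\ i = a + b, j = a + c & l = b + c]%N) (fusion_ok i j l).
Proof.
apply: (iffP existsP) => [[t /eqP <-]|[a [b [c [-> -> ->]]]]].
  have := ltn_ord t; rewrite /fusion_index; move: (nat_of_ord t) => {}t lt.
  (* The block number [t] is the smaller of [b] and [c]. *)
  have /orP[ij|ji] := leq_total i j.
    exists (i - t)%N, t, (j - i + t)%N.
    by split; lia.
  exists (j - t)%N, (i - j + t)%N, t.
  by split; lia.
have lt : (minn b c < (minn (a + b) (a + c)).+1)%N by lia.
by exists (Ordinal lt); rewrite /fusion_index /=; apply/eqP; lia.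
Qed.

Lemma V_complete_pair i j p q p' q' l l' :
  (forall t, (t < (minn i j).+1)%N = (t < 2)%N) ->
  fusion_index i j 0 = l -> fusion_index i j 1 = l' ->
  \sum_(s < d l) V i j s p q * (V i j s p' q')^*%R +
  \sum_(s < d l') V i j s p q * (V i j s p' q')^*%R = (p == p')%:R * (q == q')%:R.
Proof.
move=> ij <- <-; rewrite -V_complete.
have -> : (minn i j).+1 = 2%N by have := ij 1%N; have := ij 2%N; lia.
by rewrite big_ord_recl big_ord1.
Qed.

Lemma V_complete_single i j p q p' q' l : minn i j = 0%N ->
  fusion_index i j 0 = l ->
  \sum_(s < d l) V i j s p q * (V i j s p' q')^*%R = (p == p')%:R * (q == q')%:R.
Proof. by move=> ij <-; rewrite -V_complete ij big_ord1. Qed.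

(** * The invariant vector of [H_1 (x) H_1] and Wenzl's recursion *)

Variables (N : nat) (Rm : 'M[C]_(d 1)) (eps : C).
Notation "[ k ]q" := (bracket (N%:R : R) k) (format "[ k ]q").
Hypothesis N3 : (3 <= N)%N.
Hypothesis d_bracket : forall k, (d k)%:R = [k.+1]q.
Hypothesis Rm_unitaryr : Rm *m adjC_mx Rm = 1%:M.
Hypothesis Rm_unitaryl : adjC_mx Rm *m Rm = 1%:M.
Hypothesis Rm_conj : Rm *m conjC_mx Rm = eps%:M.
Hypothesis eps_norm : eps * eps^*%R = 1.
Hypothesis Rm_inv : forall x y,
  \sum_z \sum_u Rm z u *: (w 1 x z * w 1 y u) = (Rm x y)%:A.

Lemma unitary_mix (V : lmodType C) (F : 'I_(d 1) -> 'I_(d 1) -> V) :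
  \sum_x \sum_y \sum_z ((Rm x y)^*%R * Rm x z) *: F y z = \sum_y F y y.
Proof.
rewrite exchange_big; apply: eq_bigr => y _; rewrite exchange_big /=.
rewrite (bigD1 y) //= [X in _ + X]big1 ?addr0 => [|z /negbTE zy].
  rewrite -scaler_suml; have /matrixP/(_ y y) := Rm_unitaryl.
  rewrite !mxE eqxx => E; rewrite (eq_bigr (fun x => adjC_mx Rm y x * Rm x y)).
    by rewrite E scale1r.
  by move=> x _; rewrite adjC_mxE.
rewrite -scaler_suml; have /matrixP/(_ y z) := Rm_unitaryl.
rewrite !mxE eq_sym zy => E; rewrite (eq_bigr (fun x => adjC_mx Rm y x * Rm x z)).
  by rewrite E scale0r.
by move=> x _; rewrite adjC_mxE.
Qed.

Lemma unitary_mixT (V : lmodType C) (F : 'I_(d 1) -> 'I_(d 1) -> V) :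
  \sum_x \sum_y \sum_z ((Rm y x)^*%R * Rm z x) *: F y z = \sum_y F y y.
Proof.
rewrite exchange_big; apply: eq_bigr => y _; rewrite exchange_big /=.
have E z : \sum_x (Rm y x)^*%R * Rm z x = (z == y)%:R.
  have /matrixP/(_ z y) := Rm_unitaryr; rewrite !mxE => <-.
  by apply: eq_bigr => x _; rewrite adjC_mxE mulrC.
rewrite (bigD1 y) //= -scaler_suml E eqxx scale1r big1 ?addr0 // => z /negbTE zy.
by rewrite -scaler_suml E zy scale0r.
Qed.

Definition raise_r k x : 'M[C]_(d k, d k.+1) := \matrix_(p, s) V k 1 s p x.
Definition raise_l k y : 'M[C]_(d k, d k.+1) := \matrix_(q, s) V 1 k s y q.
(** The suffix [h] marks a twist by the invariant vector [Rm]. The right tensor factor acts by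
    transposes, so the adjoint of [raise_l] appears there as its conjugate [raise_lc]. *)
Definition raise_rh k x : 'M[C]_(d k, d k.+1) :=
  \sum_z (Rm z x)^*%R *: raise_r k z.
Definition raise_lc k y : 'M[C]_(d k, d k.+1) := conjC_mx (raise_l k y).
Definition raise_lh k x : 'M[C]_(d k, d k.+1) := \sum_y Rm x y *: raise_lc k y.

Lemma raise_r_iso k : \sum_z adjC_mx (raise_r k z) *m raise_r k z = 1%:M.
Proof.
have ok : fusion_ok k 1 k.+1 by apply/fusion_okP; exists 0%N, k, 1%N; rewrite !add0n addn1.
apply/matrixP => s t; rewrite summxE [RHS]mxE -(V_on ok) hs_dotE exchange_big.
by apply: eq_bigr => x _; rewrite mxE; apply: eq_bigr => p _; rewrite !mxE.
Qed.

Lemma raise_l_iso k : \sum_z adjC_mx (raise_l k z) *m raise_l k z = 1%:M.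
Proof.
have ok : fusion_ok 1 k k.+1 by apply/fusion_okP; exists 0%N, 1%N, k; rewrite !add0n add1n.
apply/matrixP => s t; rewrite summxE [RHS]mxE -(V_on ok) hs_dotE.
by apply: eq_bigr => x _; rewrite mxE; apply: eq_bigr => p _; rewrite !mxE.
Qed.

Lemma conjC_mxM m n p (M : 'M[C]_(m, n)) (M' : 'M[C]_(n, p)) :
  conjC_mx (M *m M') = conjC_mx M *m conjC_mx M'.
Proof. exact: map_mxM. Qed.

Lemma adjC_mx_conj m n (M : 'M[C]_(m, n)) :
  adjC_mx (conjC_mx M) = conjC_mx (adjC_mx M).
Proof. by apply/matrixP => i j; rewrite !mxE. Qed.

Lemma conjC_mx_sum m n (I : finType) (F : I -> 'M[C]_(m, n)) :
  conjC_mx (\sum_i F i) = \sum_i conjC_mx (F i).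
Proof.
by apply/matrixP => i j; rewrite !(mxE, summxE) rmorph_sum;
  apply: eq_bigr => k _; rewrite !mxE.
Qed.

Lemma conjC_mxB m n (M M' : 'M[C]_(m, n)) :
  conjC_mx (M - M') = conjC_mx M - conjC_mx M'.
Proof. exact: map_mxB. Qed.

Lemma conjC_mxZ m n a (M : 'M[C]_(m, n)) :
  conjC_mx (a *: M) = a^*%R *: conjC_mx M.
Proof. exact: map_mxZ. Qed.

Lemma conj_real_complex (r : R) : (r%:C)^*%R = r%:C :> C.
Proof. by apply/conj_Creal/complex_realP; exists r. Qed.

Lemma conjC_mx_scalar n (c : C) : conjC_mx (c%:M : 'M[C]_n) = (c^*%R)%:M.
Proof. exact: map_scalar_mx. Qed.

Lemma raise_lc_iso k : \sum_z adjC_mx (raise_lc k z) *m raise_lc k z = 1%:M.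
Proof.
have := congr1 (@conjC_mx R _ _) (raise_l_iso k).
rewrite conjC_mx_sum conjC_mx_scalar rmorph1 => <-.
by apply: eq_bigr => z _; rewrite conjC_mxM adjC_mx_conj.
Qed.

Lemma raise_lh_iso k : \sum_z adjC_mx (raise_lh k z) *m raise_lh k z = 1%:M.
Proof.
rewrite -(raise_lc_iso k) -[RHS](unitary_mix (fun y z =>
   adjC_mx (raise_lc k y) *m raise_lc k z)).
apply: eq_bigr => x _; rewrite adjC_mx_sum mulmx_suml; apply: eq_bigr => y _.
rewrite mulmx_sumr; apply: eq_bigr => z _.
by rewrite adjC_mxZ -scalemxAl -scalemxAr scalerA.
Qed.

Lemma raise_hat_create m n (v : 'M[C]_(d m, d n)) :
  \sum_z adjC_mx (raise_rh m z) *m v *m raise_lc n z =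
  \sum_z adjC_mx (raise_r m z) *m v *m raise_lh n z.
Proof.
under [RHS]eq_bigr do rewrite mulmx_sumr.
rewrite [RHS]exchange_big; apply: eq_bigr => x _ /=.
rewrite adjC_mx_sum !mulmx_suml; apply: eq_bigr => y _.
by rewrite adjC_mxZ conjCK -!scalemxAl -scalemxAr.
Qed.

Lemma raise_hat_annihilate m n (v : 'M[C]_(d m.+1, d n.+1)) :
  \sum_z raise_rh m z *m v *m adjC_mx (raise_lc n z) =
  \sum_z raise_r m z *m v *m adjC_mx (raise_lh n z).
Proof.
under [RHS]eq_bigr do rewrite adjC_mx_sum mulmx_sumr.
rewrite [RHS]exchange_big; apply: eq_bigr => x _ /=.
rewrite !mulmx_suml; apply: eq_bigr => y _.
by rewrite adjC_mxZ -!scalemxAl -scalemxAr.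
Qed.

(* The invariant vector [Rm] turns the isometry of [H_k+1] into [H_k (x) H_1]
   into a copy of [H_k] inside [H_k+1 (x) H_1], and similarly on the left. *)
Definition lower_r k (s : 'I_(d k)) : 'M[C]_(d k.+1, d 1) :=
  \matrix_(p, x) adjC_mx (raise_rh k x) p s.
Definition lower_l k (s : 'I_(d k)) : 'M[C]_(d 1, d k.+1) :=
  \matrix_(y, q) \sum_x Rm y x * (raise_l k x s q)^*%R.

Lemma lower_rE k s p x :
  lower_r s p x = \sum_y Rm y x * (V k 1 p s y)^*%R.
Proof.
rewrite mxE adjC_mx_sum summxE; apply: eq_bigr => y _.
by rewrite adjC_mxZ mxE conjCK adjC_mxE mxE.
Qed.

Lemma lower_lE k s y q :
  lower_l s y q = \sum_x Rm y x * (V 1 k q x s)^*%R.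
Proof. by rewrite mxE; apply: eq_bigr => x _; rewrite mxE. Qed.

Lemma lower_r_hom k : is_hom w (@lower_r k).
Proof.
move=> p x s.
transitivity (\sum_u \sum_v (V k 1 p u v)^*%R *: (w k u s * (Rm v x)%:A)); last first.
  apply: eq_bigr => u _; rewrite lower_rE scaler_suml; apply: eq_bigr => v _.
  by rewrite mulr_algr scalerA mulrC.
transitivity (\sum_y \sum_x' Rm y x' *: ((\sum_p' (V k 1 p' s y)^*%R *: w k.+1 p p')
    * w 1 x x')).
  rewrite exchange_big [RHS]exchange_big /=; apply: eq_bigr => x' _.
  under eq_bigr => p' _ do rewrite lower_rE scaler_suml.
  rewrite exchange_big; apply: eq_bigr => y _ /=.
  rewrite mulr_suml scaler_sumr; apply: eq_bigr => p' _.
  by rewrite -scalerAl scalerA.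
under eq_bigr => y _ do under eq_bigr => x' _ do rewrite -V_cohom mulr_suml scaler_sumr.
under eq_bigr => y _ do rewrite exchange_big /=.
rewrite exchange_big; apply: eq_bigr => u _ /=.
under eq_bigr => y _ do under eq_bigr => x' _ do rewrite mulr_suml scaler_sumr.
under eq_bigr => y _ do rewrite exchange_big /=.
rewrite exchange_big; apply: eq_bigr => v _ /=.
rewrite -Rm_inv mulr_sumr scaler_sumr; apply: eq_bigr => y _.
rewrite mulr_sumr scaler_sumr; apply: eq_bigr => x' _.
by rewrite -scalerAl -scalerAr mulrA !scalerA mulrC.
Qed.

Lemma lower_l_hom k : is_hom w (@lower_l k).
Proof.
move=> y q s.
transitivity (\sum_u \sum_v (V 1 k q u v)^*%R *: ((Rm y u)%:A * w k v s)); last first.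
  rewrite exchange_big; apply: eq_bigr => v _ /=.
  rewrite lower_lE scaler_suml; apply: eq_bigr => u _.
  by rewrite mulr_algl scalerA mulrC.
transitivity (\sum_y' \sum_x Rm y' x *: (w 1 y y' *
    (\sum_q' (V 1 k q' x s)^*%R *: w k.+1 q q'))).
  apply: eq_bigr => y' _.
  under eq_bigr => q' _ do rewrite lower_lE scaler_suml.
  rewrite exchange_big; apply: eq_bigr => x _ /=.
  rewrite mulr_sumr scaler_sumr; apply: eq_bigr => q' _.
  by rewrite -scalerAr scalerA.
under eq_bigr => y' _ do under eq_bigr => x _ do rewrite -V_cohom mulr_sumr scaler_sumr.
under eq_bigr => y' _ do rewrite exchange_big /=.
rewrite exchange_big; apply: eq_bigr => u _ /=.
under eq_bigr => y' _ do under eq_bigr => x _ do rewrite mulr_sumr scaler_sumr.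
under eq_bigr => y' _ do rewrite exchange_big /=.
rewrite exchange_big; apply: eq_bigr => v _ /=.
rewrite -Rm_inv mulr_suml scaler_sumr; apply: eq_bigr => y' _.
rewrite mulr_suml scaler_sumr; apply: eq_bigr => x _.
by rewrite -scalerAl -scalerAr mulrA !scalerA mulrC.
Qed.

Lemma d_bracketC k : (d k)%:R = ([k.+1]q)%:C :> C.
Proof. by rewrite -d_bracket rmorph_nat. Qed.

Lemma trace_sum_adj m n (I : finType) (F : I -> 'M[C]_(m, n)) :
  \tr (\sum_z F z *m adjC_mx (F z)) = \tr (\sum_z adjC_mx (F z) *m F z).
Proof. by rewrite !raddf_sum; apply: eq_bigr => z _; rewrite /= mxtrace_mulC. Qed.

Let x3 : 3 <= N%:R :> R. Proof. by rewrite ler_nat. Qed.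

Let bracket_neq0 k : [k.+1]q != 0.
Proof. by rewrite gt_eqF // bracket_gt0. Qed.

(** Comparing traces identifies the scalar with the ratio of dimensions [d_(k+1) / d_k]. *)
Lemma gram_constant k (c : C) (F : 'I_(d 1) -> 'M[C]_(d k, d k.+1)) :
  \sum_z adjC_mx (F z) *m F z = 1%:M ->
  \sum_z F z *m adjC_mx (F z) = c%:M -> c = ([k.+2]q / [k.+1]q)%:C.
Proof.
move=> isoF Fc; have := trace_sum_adj F; rewrite isoF Fc !mxtrace_scalar.
rewrite -[c *+ _]mulr_natr !d_bracketC => E.
have k0 : ([k.+1]q)%:C != 0 :> C.
  by rewrite (inj_eq (@complexI R)).
by rewrite rmorphM fmorphV /=; apply: (canRL (mulfK k0)).
Qed.

(** Uniqueness makes [lower_r] a multiple of [V]. Its Gram matrix is the sum over [raise_rh], and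
    the twist by the unitary [Rm] drops out of that sum, which leaves the one over [raise_r]. *)
Lemma lower_r_const k : exists2 c : C, c * c^*%R = ([k.+2]q / [k.+1]q)%:C &
  (forall s, @lower_r k s = c *: V k.+1 1 s) /\
  \sum_z raise_r k z *m adjC_mx (raise_r k z) = (c * c^*%R)%:M.
Proof.
have [c cE] := hom_unique (@lower_r_hom k).
have ok : fusion_ok k.+1 1 k.
  by apply/fusion_okP; exists 1%N, k, 0%N; rewrite !add1n addn0.
have E : \sum_z raise_r k z *m adjC_mx (raise_r k z) = (c * c^*%R)%:M.
  rewrite -[LHS](unitary_mixT (fun y z => raise_r k y *m adjC_mx (raise_r k z))).
  transitivity (\sum_x raise_rh k x *m adjC_mx (raise_rh k x)).
    apply: eq_bigr => x _; rewrite adjC_mx_sum mulmx_suml.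
    apply: eq_bigr => y _; rewrite mulmx_sumr; apply: eq_bigr => z _.
    by rewrite adjC_mxZ conjCK -scalemxAl -scalemxAr scalerA.
  apply/matrixP => s s'; rewrite summxE [RHS]mxE -mulr_natr -(V_on ok).
  transitivity (\tr (adjC_mx (lower_r s) *m lower_r s')); last first.
    by rewrite !cE adjC_mxZ -scalemxAl -scalemxAr !mxtraceZ mulrA (mulrC c).
  rewrite hs_dotE exchange_big; apply: eq_bigr => x _ /=.
  rewrite mxE; apply: eq_bigr => p _.
  by rewrite !mxE conjCK.
exists c; last by [].
exact: gram_constant (raise_r_iso k) E.
Qed.

Lemma raise_r_trace k :
  \sum_z raise_r k z *m adjC_mx (raise_r k z) = ([k.+2]q / [k.+1]q)%:C%:M.
Proof. by have [c <- [_ ->]] := lower_r_const k. Qed.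

Lemma raise_r_wenzl0 y z : raise_r 0 y *m adjC_mx (raise_r 0 z) = (y == z)%:R%:M.
Proof.
apply/matrixP => p p'; rewrite mxE.
rewrite (eq_bigr (fun s => V 0 1 s p y * (V 0 1 s p' z)^*%R)) => [|s _]; last first.
  by rewrite adjC_mxE !mxE.
rewrite (@V_complete_single 0 1 p y p' z 1) //.
by rewrite mxE -natrM mulnb; case: eqP; case: eqP.
Qed.

Lemma bracket_ratioK k :
  ([k.+1]q / [k.+2]q)%:C * ([k.+2]q / [k.+1]q)%:C = 1 :> C.
Proof.
by rewrite -rmorphM mulrA mulfVK // mulfV // rmorph1.
Qed.

(** [H_k.+1 (x) H_1] decomposes into [H_k] and [H_k.+2]. The left side projects onto the second; the
    first is the range of [lower_r], of squared norm [[k.+2]q / [k.+1]q]. *)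
Lemma raise_r_wenzlS k y z : raise_r k.+1 y *m adjC_mx (raise_r k.+1 z) =
  (y == z)%:R%:M -
  ([k.+1]q / [k.+2]q)%:C *: (adjC_mx (raise_rh k y) *m raise_rh k z).
Proof.
have [c c2 [cE _]] := lower_r_const k.
apply/matrixP => p p'.
have pair : \sum_(s < d k) V k.+1 1 s p y * (V k.+1 1 s p' z)^*%R +
    \sum_(s < d k.+2) V k.+1 1 s p y * (V k.+1 1 s p' z)^*%R =
    (p == p')%:R * (y == z)%:R.
  by apply: V_complete_pair => [t| |]; rewrite /fusion_index; lia.
have -> : (raise_r k.+1 y *m adjC_mx (raise_r k.+1 z)) p p' =
    \sum_(s < d k.+2) V k.+1 1 s p y * (V k.+1 1 s p' z)^*%R.
  by rewrite mxE; apply: eq_bigr => s _; rewrite adjC_mxE !mxE.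
rewrite -[LHS](addKr (\sum_(s < d k) V k.+1 1 s p y * (V k.+1 1 s p' z)^*%R)) pair.
rewrite addrC [RHS]mxE [X in _ = X + _]mxE [X in _ = _ + X]mxE; congr (_ - _).
  by rewrite -natrM mulnb; case: eqP; case: eqP.
rewrite [in RHS]mxE [X in _ = _ * X]mxE.
rewrite [X in _ = _ * X](eq_bigr (fun s => (c * c^*%R) *
   (V k.+1 1 s p y * (V k.+1 1 s p' z)^*%R))) => [|s _].
  by rewrite -mulr_sumr c2 mulrA bracket_ratioK mul1r.
have low u v : adjC_mx (raise_rh k v) u s = c * V k.+1 1 s u v.
  by have /matrixP/(_ u v) := cE s; rewrite [LHS]mxE [RHS]mxE.
by rewrite low -[raise_rh k z s p']conjCK -adjC_mxE low rmorphM mulrACA.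
Qed.

Definition lower_lmx k u : 'M[C]_(d k.+1, d k) := \matrix_(q, s) @lower_l k s u q.

Lemma lower_lmxE k u :
  conjC_mx (lower_lmx k u) = \sum_x (Rm u x)^*%R *: adjC_mx (raise_lc k x).
Proof.
apply/matrixP => q s; rewrite !mxE summxE rmorph_sum; apply: eq_bigr => x _.
by rewrite mxE adjC_conj_mx !mxE rmorphM /= conjCK.
Qed.

Lemma lower_l_const k : exists2 c : C, c * c^*%R = ([k.+2]q / [k.+1]q)%:C &
  forall s, @lower_l k s = c *: V 1 k.+1 s.
Proof.
have [c cE] := hom_unique (@lower_l_hom k).
have ok : fusion_ok 1 k.+1 k.
  by apply/fusion_okP; exists 1%N, 0%N, k; rewrite !add1n add0n.
have E : \sum_z raise_lc k z *m adjC_mx (raise_lc k z) = (c^*%R * c)%:M.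
  rewrite -[LHS](unitary_mix (fun y z => raise_lc k z *m adjC_mx (raise_lc k y))).
  transitivity (\sum_u adjC_mx (conjC_mx (lower_lmx k u)) *m conjC_mx (lower_lmx k u)).
    apply: eq_bigr => u _; rewrite lower_lmxE adjC_mx_sum mulmx_sumr.
    apply: eq_bigr => y _; rewrite mulmx_suml; apply: eq_bigr => z _.
    by rewrite adjC_mxZ conjCK adjC_mxK -scalemxAl -scalemxAr scalerA mulrC.
  apply/matrixP => s s'; rewrite summxE [RHS]mxE -mulr_natr eq_sym -(V_on ok).
  transitivity (\tr (adjC_mx (lower_l s') *m lower_l s)); last first.
    by rewrite !cE adjC_mxZ -scalemxAl -scalemxAr !mxtraceZ mulrA.
  rewrite hs_dotE; apply: eq_bigr => u _; rewrite mxE; apply: eq_bigr => q _.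
  by rewrite adjC_conj_mx !mxE mulrC.
exists c => //; rewrite mulrC.
exact: gram_constant (raise_lc_iso k) E.
Qed.

Lemma raise_l_wenzlS k y z : raise_l k.+1 y *m adjC_mx (raise_l k.+1 z) =
  (y == z)%:R%:M -
  ([k.+1]q / [k.+2]q)%:C *: (lower_lmx k y *m adjC_mx (lower_lmx k z)).
Proof.
have [c c2 cE] := lower_l_const k.
apply/matrixP => p p'.
have pair : \sum_(s < d k) V 1 k.+1 s y p * (V 1 k.+1 s z p')^*%R +
    \sum_(s < d k.+2) V 1 k.+1 s y p * (V 1 k.+1 s z p')^*%R =
    (y == z)%:R * (p == p')%:R.
  by apply: V_complete_pair => [t| |]; rewrite /fusion_index; lia.
have -> : (raise_l k.+1 y *m adjC_mx (raise_l k.+1 z)) p p' =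
    \sum_(s < d k.+2) V 1 k.+1 s y p * (V 1 k.+1 s z p')^*%R.
  by rewrite mxE; apply: eq_bigr => s _; rewrite adjC_mxE !mxE.
rewrite -[LHS](addKr (\sum_(s < d k) V 1 k.+1 s y p * (V 1 k.+1 s z p')^*%R)) pair.
rewrite addrC [RHS]mxE [X in _ = X + _]mxE [X in _ = _ + X]mxE; congr (_ - _).
  by rewrite -natrM mulnb; case: eqP; case: eqP.
rewrite [in RHS]mxE [X in _ = _ * X]mxE.
rewrite [X in _ = _ * X](eq_bigr (fun s => (c * c^*%R) *
   (V 1 k.+1 s y p * (V 1 k.+1 s z p')^*%R))) => [|s _].
  by rewrite -mulr_sumr c2 mulrA bracket_ratioK mul1r.
have low u q : lower_lmx k u q s = c * V 1 k.+1 s u q by rewrite mxE cE mxE.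
by rewrite adjC_mxE !low rmorphM mulrACA.
Qed.

(** The two twists compose to [Rm *m conjC_mx Rm], the scalar [eps]. Only its modulus enters
    [raise_lh_wenzlS], so the sign of [F] times its conjugate disappears. *)
Lemma Rm_lower_lmx k y :
  \sum_u Rm y u *: conjC_mx (lower_lmx k u) = eps *: adjC_mx (raise_lc k y).
Proof.
under eq_bigr do rewrite lower_lmxE scaler_sumr.
rewrite exchange_big /=.
transitivity (\sum_x (Rm *m conjC_mx Rm) y x *: adjC_mx (raise_lc k x)).
  apply: eq_bigr => x _; rewrite mxE scaler_suml; apply: eq_bigr => u _.
  by rewrite scalerA conjC_mxE.
rewrite Rm_conj (bigD1 y) //= mxE eqxx big1 ?addr0 // => x /negbTE xy.
by rewrite mxE eq_sym xy scale0r.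
Qed.

Lemma raise_lh_mul k y z : raise_lh k y *m adjC_mx (raise_lh k z) =
  \sum_u \sum_v (Rm y u * (Rm z v)^*%R) *:
    conjC_mx (raise_l k u *m adjC_mx (raise_l k v)).
Proof.
rewrite adjC_mx_sum mulmx_suml; apply: eq_bigr => u _.
rewrite mulmx_sumr; apply: eq_bigr => v _.
by rewrite adjC_mxZ -scalemxAl -scalemxAr scalerA conjC_mxM adjC_mx_conj.
Qed.

Lemma Rm_row_orth y z :
  \sum_u \sum_v (Rm y u * (Rm z v)^*%R) * (u == v)%:R = (y == z)%:R.
Proof.
have /matrixP/(_ y z) := Rm_unitaryr; rewrite !mxE => <-; apply: eq_bigr => u _.
rewrite (bigD1 u) //= eqxx mulr1 adjC_mxE big1 ?addr0 // => v /negbTE vu.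
by rewrite eq_sym vu mulr0.
Qed.

Lemma raise_lh_wenzl0 y z :
  raise_lh 0 y *m adjC_mx (raise_lh 0 z) = (y == z)%:R%:M.
Proof.
have E u v : raise_l 0 u *m adjC_mx (raise_l 0 v) = (u == v)%:R%:M.
  apply/matrixP => p p'; rewrite mxE.
  rewrite (eq_bigr (fun s => V 1 0 s u p * (V 1 0 s v p')^*%R)) => [|s _]; last first.
    by rewrite adjC_mxE !mxE.
  rewrite (@V_complete_single 1 0 u p v p' 1) //.
  by rewrite mxE -natrM mulnb; case: eqP; case: eqP.
rewrite raise_lh_mul -Rm_row_orth raddf_sum; apply: eq_bigr => u _.
rewrite raddf_sum; apply: eq_bigr => v _ /=.
by rewrite E conjC_mx_scalar rmorph_nat scale_scalar_mx.
Qed.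

Lemma raise_lh_wenzlS k y z : raise_lh k.+1 y *m adjC_mx (raise_lh k.+1 z) =
  (y == z)%:R%:M -
  ([k.+1]q / [k.+2]q)%:C *: (adjC_mx (raise_lc k y) *m raise_lc k z).
Proof.
rewrite raise_lh_mul.
transitivity (\sum_u \sum_v (((Rm y u * (Rm z v)^*%R) * (u == v)%:R)%:M -
  ([k.+1]q / [k.+2]q)%:C *: ((Rm y u *: conjC_mx (lower_lmx k u)) *m
     adjC_mx (Rm z v *: conjC_mx (lower_lmx k v))))).
  apply: eq_bigr => u _; apply: eq_bigr => v _.
  rewrite raise_l_wenzlS conjC_mxB.
  rewrite conjC_mx_scalar rmorph_nat scalerBr scale_scalar_mx; congr (_ - _).
  rewrite conjC_mxZ conj_real_complex.
  rewrite conjC_mxM adjC_mxZ adjC_mx_conj -scalemxAl -scalemxAr !scalerA.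
  by rewrite mulrC mulrA.
under eq_bigr do rewrite sumrB.
rewrite sumrB; congr (_ - _).
  rewrite -[in RHS]Rm_row_orth [in RHS]raddf_sum; apply: eq_bigr => u _.
  by rewrite [in RHS]raddf_sum.
transitivity (([k.+1]q / [k.+2]q)%:C *:
  ((\sum_u Rm y u *: conjC_mx (lower_lmx k u)) *m
   adjC_mx (\sum_v Rm z v *: conjC_mx (lower_lmx k v)))).
  rewrite adjC_mx_sum mulmx_suml scaler_sumr; apply: eq_bigr => u _.
  by rewrite mulmx_sumr scaler_sumr.
rewrite !Rm_lower_lmx adjC_mxZ adjC_mxK -scalemxAl -scalemxAr !scalerA.
by rewrite -mulrA eps_norm mulr1.
Qed.

Lemma scalar_scal_comm m n (a : A) (M : 'M[C]_(m, n)) :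
  a%:M *m scal_mx A M = scal_mx A M *m a%:M.
Proof.
apply/matrixP => i j; rewrite !mxE (bigD1 i) //= [RHS](bigD1 j) //= !mxE !eqxx.
rewrite !mulr1n mulr_algr mulr_algl !big1 // => k /negbTE ki.
  by rewrite !mxE ki mulr0n mulr0.
by rewrite !mxE eq_sym ki mulr0n mul0r.
Qed.

Lemma hom_mx i j l (Phi : 'I_(d l) -> 'M[C]_(d i, d j)) :
  is_hom w Phi <-> forall s, w i *m scal_mx A (Phi s) *m (w j)^T =
    \sum_t scal_mx A (Phi t) *m (w l t s)%:M.
Proof.
have lhsE s p q : (w i *m scal_mx A (Phi s) *m (w j)^T) p q =
    \sum_p' \sum_q' Phi s p' q' *: (w i p p' * w j q q').
  rewrite exchange_big mxE; apply: eq_bigr => q' _ /=.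
  rewrite mul_scal_mxE mxE mulr_suml; apply: eq_bigr => p' _.
  by rewrite -scalerAl.
have rhsE s p q : (\sum_t scal_mx A (Phi t) *m (w l t s)%:M) p q =
    \sum_t Phi t p q *: w l t s.
  rewrite summxE; apply: eq_bigr => t _.
  rewrite scal_mulmxE (bigD1 q) //= mxE eqxx mulr1n big1 ?addr0 // => k /negbTE kq.
  by rewrite mxE kq mulr0n scaler0.
split=> [hPhi s|hPhi p q s]; last by rewrite -lhsE hPhi rhsE.
by apply/matrixP => p q; rewrite lhsE rhsE hPhi.
Qed.

Lemma raise_r_coaction m x : w m.+1 *m scal_mx A (adjC_mx (raise_r m x)) =
  \sum_z scal_mx A (adjC_mx (raise_r m z)) *m w m *m (w 1 z x)%:M.
Proof.
apply/matrixP => s p; rewrite mul_scal_mxE summxE.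
transitivity (\sum_t (V m 1 t p x)^*%R *: w m.+1 s t).
  by apply: eq_bigr => t _; rewrite adjC_mxE mxE.
rewrite -V_cohom exchange_big; apply: eq_bigr => z _ /=.
rewrite [RHS]mxE [RHS](bigD1 p) //= [X in _ = _ + X]big1 ?addr0 => [|k /negbTE kp]; last first.
  by rewrite [X in _ * X]mxE kp mulr0n mulr0.
rewrite [X in _ = _ * X]mxE eqxx mulr1n scal_mulmxE mulr_suml.
by apply: eq_bigr => p' _; rewrite adjC_mxE mxE -scalerAl.
Qed.

Lemma raise_lc_coaction n y : scal_mx A (raise_lc n y) *m (w n.+1)^T =
  \sum_z (w 1 z y)%:M *m (w n)^T *m scal_mx A (raise_lc n z).
Proof.
apply/matrixP => q s; rewrite scal_mulmxE summxE.
transitivity (\sum_t (V 1 n t y q)^*%R *: w n.+1 s t).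
  by apply: eq_bigr => t _; rewrite !mxE.
rewrite -V_cohom; apply: eq_bigr => z _.
rewrite -mulmxA [RHS]mxE [RHS](bigD1 q) //= [X in _ = _ + X]big1 ?addr0 => [|k /negbTE kq]; last first.
  by rewrite [X in X * _]mxE eq_sym kq mulr0n mul0r.
rewrite [X in _ = X * _]mxE eqxx mulr1n mul_scal_mxE mulr_sumr.
by apply: eq_bigr => q' _; rewrite !mxE -scalerAr.
Qed.

(** * Creation operators on intertwiners *)

Notation create := (create raise_r raise_lh).
Notation annihilate := (annihilate raise_r raise_lh).

(** Moving the representation through the outer isometries leaves one copy of [w 1] on each leg of
    the inserted vector, and [Rm_inv] absorbs both copies. *)
Lemma create_hom m n l (Phi : 'I_(d l) -> 'M[C]_(d m, d n)) :
  is_hom w Phi -> is_hom w (fun s => create (Phi s)).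
Proof.
move=> /hom_mx hPhi; apply/hom_mx => s.
have scs k k' (I : finType) (F : I -> 'M[C]_(k, k')) :
    scal_mx A (\sum_i F i) = \sum_i scal_mx A (F i).
  exact: (raddf_sum (map_mx (GRing.in_alg A))).
have scZ k k' c (M : 'M[C]_(k, k')) : scal_mx A (c *: M) = (c%:A)%:M *m scal_mx A M.
  by rewrite -mul_scalar_mx scal_mxM scal_mx_scalar.
have sum_inv x y : \sum_z \sum_u (Rm z u)%:A%:M *m ((w 1 x z)%:M *m (w 1 y u)%:M) =
    (Rm x y)%:A%:M :> 'M[A]_(d n).
  rewrite -Rm_inv raddf_sum; apply: eq_bigr => z _.
  rewrite raddf_sum; apply: eq_bigr => u _ /=.
  by rewrite -!scalar_mxM mulr_algl.
rewrite /create scs mulmx_sumr mulmx_suml.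
transitivity (\sum_x \sum_y \sum_z \sum_u scal_mx A (adjC_mx (raise_r m z)) *m w m *m
   scal_mx A (Phi s) *m ((Rm x y)%:A%:M *m ((w 1 z x)%:M *m (w 1 u y)%:M)) *m
   (w n)^T *m scal_mx A (raise_lc n u)).
  apply: eq_bigr => x _; rewrite !scal_mxM !mulmxA raise_r_coaction scs.
  rewrite mulmx_sumr mulmx_suml; apply: eq_bigr => y _.
  rewrite scZ -!mulmxA raise_lc_coaction !mulmxA !mulmx_suml.
  apply: eq_bigr => z _; rewrite mulmx_sumr; apply: eq_bigr => u _.
  rewrite -!mulmxA; congr (_ *m (_ *m _)); rewrite !mulmxA scalar_scal_comm.
  rewrite -!mulmxA; congr (_ *m _); rewrite !mulmxA.
  rewrite -[(w 1 z x)%:M *m _]scalar_mxM mulr_algr.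
  by rewrite -[(Rm x y)%:A%:M *m _]scalar_mxM mulr_algl.
under eq_bigr => x _ do rewrite exchange_big /=.
rewrite exchange_big /=.
under eq_bigr => z _ do under eq_bigr => x _ do rewrite exchange_big /=.
under eq_bigr => z _ do rewrite exchange_big /=.
transitivity (\sum_z \sum_u scal_mx A (adjC_mx (raise_r m z)) *m
    (w m *m scal_mx A (Phi s) *m (w n)^T) *m
    ((Rm z u)%:A%:M *m scal_mx A (raise_lc n u))).
  apply: eq_bigr => z _; apply: eq_bigr => u _.
  have E : (w n)^T *m (Rm z u)%:A%:M = (Rm z u)%:A%:M *m (w n)^T :> 'M[A]__.
    rewrite -!scal_mx_scalar; apply/matrixP => a b.
    rewrite mul_scal_mxE scal_mulmxE (bigD1 b) //= [RHS](bigD1 a) //= !mxE !eqxx.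
    rewrite !big1 // => k /negbTE ka; rewrite mxE.
      by rewrite eq_sym ka mulr0n scale0r.
    by rewrite ka mulr0n scale0r.
  rewrite -!mulmxA [X in _ = _ *m (_ *m (_ *m X))]mulmxA E -sum_inv.
  rewrite !mulmx_suml !mulmx_sumr; apply: eq_bigr => x _.
  by rewrite !mulmx_suml !mulmx_sumr; apply: eq_bigr => y _; rewrite !mulmxA.
have hG := hPhi s; set G := (X in X = _) in hG.
transitivity (\sum_z scal_mx A (adjC_mx (raise_r m z)) *m G *m scal_mx A (raise_lh n z)).
  apply: eq_bigr => z _; rewrite scs mulmx_sumr; apply: eq_bigr => u _.
  by rewrite scZ.
under [LHS]eq_bigr => z _ do rewrite hG mulmx_sumr mulmx_suml.
rewrite exchange_big; apply: eq_bigr => t _ /=.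
rewrite scs mulmx_suml; apply: eq_bigr => z _.
by rewrite !scal_mxM -!mulmxA scalar_scal_comm.
Qed.

(** Pairing with a basis vector of [H_b (x) H_c] becomes pairing with its image under [create], an
    intertwiner from some [H_e] with [e <= b + c]. That is orthogonal to the component of degree
    [b.+1 + c.+1]. *)
Lemma V_vacuum b c s : vacuum raise_r raise_lh (V b c (l := (b + c)%N) s).
Proof.
case: b c s => [|b] [|c] s //=; rewrite [LHS]V_expand big1 // => t _.
rewrite big1 // => r _; rewrite -create_adj.
have -> : \tr (adjC_mx (create (V b c r)) *m V b.+1 c.+1 s) = 0; last by rewrite scale0r.
rewrite -[create _]adjC_mxK adjC_mxK -[V b.+1 c.+1 s]adjC_mxK -adjC_mulmx mxtrace_adjC.
rewrite (hom_orth (Phi := fun r => create (V b c r))) ?rmorph0 //.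
  exact/create_hom/V_hom.
by have := ltn_ord t; rewrite /fusion_index; lia.
Qed.

Lemma V_tau a b c Z X Y :
  `|tau (V (a + b) (a + c) (l := (b + c)%N)) Z X Y| <=
  (hs_norm Z * hs_norm X * hs_norm Y / mu N%:R a b c)%:C.
Proof.
have on0 : orthonormal_fam (V b c (l := (b + c)%N)).
  by apply: V_on; apply/fusion_okP; exists 0%N, b, c.
pose tw := tower raise_r raise_lh (V b c (l := (b + c)%N)) a.
have tw_hom : is_hom w tw.
  rewrite /tw; move: (a) => a'; elim: a' => [|a' IH] /=; first exact: V_hom.
  exact: (create_hom IH).
have [k kE] := hom_unique tw_hom.
have gram s t : \tr (adjC_mx (tw s) *m tw t) = (s == t)%:R * (mu N%:R a b c)%:C.
  apply: (tower_gram x3 raise_lc_iso raise_r_trace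
    raise_r_wenzl0 raise_lh_wenzl0 raise_r_wenzlS raise_lh_wenzlS
    raise_hat_create raise_hat_annihilate on0 (@V_vacuum b c)).
have contr : tau_contractive tw.
  exact: (tower_contractive raise_r_iso raise_lh_iso on0).
have mu0 : 0 < mu N%:R a b c :> R by exact: mu_gt0.
have ok : fusion_ok (a + b) (a + c) (b + c) by apply/fusion_okP; exists a, b, c.
(* A basis vector is needed to read off the modulus of [k] from the Gram matrix of the tower. *)
have d0 : (0 < d (b + c))%N.
  rewrite lt0n; apply/negP => /eqP d0; have := bracket_neq0 (b + c).
  by rewrite -d_bracket d0 eqxx.
have kk : k^*%R * k = (mu N%:R a b c)%:C.
  have := gram (Ordinal d0) (Ordinal d0); rewrite eqxx mul1r => <-.
  by rewrite !kE adjC_mxZ -scalemxAl -scalemxAr !mxtraceZ (V_on ok) eqxx mulr1.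
have tauE : tau tw Z X Y =
    (mu N%:R a b c)%:C * tau (V (a + b) (a + c) (l := (b + c)%N)) Z X Y.
  rewrite /tau mulr_sumr; apply: eq_bigr => s _; rewrite mulr_sumr.
  apply: eq_bigr => t _; rewrite !kE adjC_mxZ -!scalemxAl -scalemxAr -!scalemxAl.
  by rewrite !mxtraceZ -kk; ring.
have := contr Z X Y; rewrite tauE normrM ger0_norm ?ler0c ?(ltW mu0) // => le.
by rewrite [in X in _ <= X]rmorphM fmorphV /= ler_pdivlMr ?ltcR // mulrC.
Qed.

(** [V k 1] exhibits [w k.+1] inside [w k (x) w 1]. For the tensor product the sum collapses in the
    index of [w k], the inner pair of factors, and afterwards in that of [w 1]. *)
Lemma kac_all k : kac_mx (w 0) -> kac_mx (w 1) -> kac_mx (w k).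
Proof.
move=> kac0 kac1; elim: k => [//|k kack] a b.
have ok : fusion_ok k 1 k.+1.
  by apply/fusion_okP; exists 0%N, k, 1%N; rewrite !add0n addn1.
pose D s (px : 'I_(d k) * 'I_(d 1)) : A :=
  \sum_r (V k 1 r px.1 px.2)^*%R *: w k.+1 s r.
have DE s px : D s px = \sum_qy (V k 1 s qy.1 qy.2)^*%R *:
    (w k qy.1 px.1 * w 1 qy.2 px.2).
  by rewrite /D -V_cohom pair_bigA.
have wE s t : w k.+1 s t = \sum_px V k 1 t px.1 px.2 *: D s px.
  under eq_bigr do rewrite scaler_sumr.
  rewrite exchange_big (bigD1 t) //= [X in _ = _ + X]big1 => [|r /negbTE rt].
    under eq_bigr do rewrite scalerA mulrC.
    rewrite -scaler_suml -(pair_bigA _ (fun p x => (V k 1 t p x)^*%R * V k 1 t p x)).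
    by rewrite /= -hs_dotE (V_on ok) eqxx scale1r addr0.
  under eq_bigr do rewrite scalerA mulrC.
  rewrite -scaler_suml -(pair_bigA _ (fun p x => (V k 1 r p x)^*%R * V k 1 t p x)).
  by rewrite /= -hs_dotE (V_on ok) rt scale0r.
transitivity (\sum_px star (D a px) * D b px).
  under eq_bigr do rewrite wE star_sum mulr_suml.
  rewrite exchange_big; apply: eq_bigr => px _ /=.
  rewrite [D b px]/D mulr_sumr; apply: eq_bigr => t _.
  by rewrite starZ -scalerAl -scalerAr.
transitivity (\sum_qy \sum_rz (V k 1 a qy.1 qy.2 * (V k 1 b rz.1 rz.2)^*%R) *:
    \sum_px star (w k qy.1 px.1 * w 1 qy.2 px.2) * (w k rz.1 px.1 * w 1 rz.2 px.2)).
  under [RHS]eq_bigr do under eq_bigr do rewrite scaler_sumr.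
  under [RHS]eq_bigr do rewrite exchange_big /=.
  rewrite [RHS]exchange_big; apply: eq_bigr => px _ /=.
  rewrite !DE star_sum mulr_suml; apply: eq_bigr => qy _.
  rewrite mulr_sumr; apply: eq_bigr => rz _.
  by rewrite starZ conjCK -scalerAl -scalerAr scalerA.
have inner (q r : 'I_(d k)) (y z : 'I_(d 1)) :
    \sum_(px : 'I_(d k) * 'I_(d 1))
      star (w k q px.1 * w 1 y px.2) * (w k r px.1 * w 1 z px.2) =
    ((q == r)%:R * (y == z)%:R)%:A.
  rewrite -(pair_bigA _ (fun p x => star (w k q p * w 1 y x) * (w k r p * w 1 z x))) /=.
  rewrite exchange_big /=.
  transitivity (\sum_x (star (w 1 y x) * (\sum_p star (w k q p) * w k r p)) * w 1 z x).
    apply: eq_bigr => x _; rewrite mulr_sumr mulr_suml; apply: eq_bigr => p _.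
    by rewrite starM !mulrA.
  rewrite kack; case: eqP => _; last first.
    by rewrite big1 ?mul0r ?scale0r // => x _; rewrite mulr0 mul0r.
  under eq_bigr do rewrite mulr1.
  by rewrite kac1 mul1r; case: eqP => _; rewrite ?scale1r ?scale0r.
transitivity (\sum_(qy : 'I_(d k) * 'I_(d 1))
   (V k 1 a qy.1 qy.2 * (V k 1 b qy.1 qy.2)^*%R) *: (1 : A)).
  apply: eq_bigr => -[q y] _ /=; rewrite (bigD1 (q, y)) //= inner !eqxx mulr1.
  rewrite scale1r big1 ?addr0 // => -[r z] /=; rewrite xpair_eqE negb_and inner.
  rewrite (eq_sym r) (eq_sym z).
  by case/orP => /negbTE ->; rewrite ?mul0r ?mulr0 scale0r scaler0.
rewrite -scaler_suml.
rewrite -(pair_bigA _ (fun p x => V k 1 a p x * (V k 1 b p x)^*%R)) /=.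
under eq_bigr do under eq_bigr do rewrite mulrC.
by rewrite -hs_dotE (V_on ok) eq_sym; case: eqP => _; rewrite ?scale1r ?scale0r.
Qed.

(** * Haar state of products of coefficients *)

Variable h : {scalar A}.
Hypothesis h_orth_neq : forall l e a p s t, l <> e ->
  h (star (w l a p) * w e s t) = 0.
Hypothesis h_orth : forall l a p s t,
  h (star (w l a p) * w l s t) = (a == s)%:R * (p == t)%:R / (d l)%:R.

Definition coef_elt k (X : 'M[C]_(d k)) : A := \sum_i \sum_j X i j *: w k i j.

Lemma haar_coef_neq k l (Z : 'M[C]_(d k)) (X : 'M[C]_(d l)) : k <> l ->
  h (star (coef_elt Z) * coef_elt X) = 0.
Proof.
move=> kl; rewrite star_sum mulr_suml raddf_sum big1 // => a _ /=.
rewrite star_sum mulr_suml raddf_sum big1 // => p _ /=.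
rewrite mulr_sumr raddf_sum big1 // => s _ /=.
rewrite mulr_sumr raddf_sum big1 // => t _ /=.
by rewrite starZ -scalerAl -scalerAr !linearZ /= h_orth_neq // !mulr0.
Qed.

Lemma haar_coef_sqr k (X : 'M[C]_(d k)) :
  h (star (coef_elt X) * coef_elt X) = (hs_norm X ^+ 2 / (d k)%:R)%:C.
Proof.
rewrite rmorphM fmorphV /= rmorph_nat hs_norm_sqr hs_sqrE star_sum !mulr_suml.
rewrite raddf_sum; apply: eq_bigr => a _ /=.
rewrite star_sum !mulr_suml raddf_sum; apply: eq_bigr => p _ /=.
rewrite mulr_sumr raddf_sum (bigD1 a) //= [X in _ + X]big1 ?addr0 => [|s /negbTE sa].
  rewrite mulr_sumr raddf_sum (bigD1 p) //= [X in _ + X]big1 ?addr0 => [|t /negbTE tp].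
    rewrite starZ -scalerAl -scalerAr !linearZ /= h_orth !eqxx normCK. by rewrite !mul1r mulrA [in RHS](mulrC (X a p)).
  rewrite starZ -scalerAl -scalerAr !linearZ /= h_orth [p == t]eq_sym tp.
  by rewrite mulr0 mul0r !mulr0.
rewrite mulr_sumr raddf_sum big1 // => t _ /=.
rewrite starZ -scalerAl -scalerAr !linearZ /= h_orth [a == s]eq_sym sa.
by rewrite !mul0r !mulr0.
Qed.

Lemma haar_triple_coef i j l a p b q c r :
  h (star (w l a p) * (w i b q * w j c r)) =
  V i j a b c * (V i j p q r)^*%R / (d l)%:R.
Proof.
rewrite coef_mul mulr_sumr raddf_sum /=.
have [/existsP[t /eqP tl]|nok] := boolP (fusion_ok i j l); last first.
  rewrite V_eq0 // mxE !mul0r big1 // => t _.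
  have tl : l <> fusion_index i j t.
    by move=> E; move/existsPn: nok => /(_ t); rewrite E eqxx.
  rewrite mulr_sumr raddf_sum big1 // => s _ /=.
  rewrite mulr_sumr raddf_sum big1 // => s' _ /=.
  by rewrite -scalerAr linearZ /= h_orth_neq ?mulr0.
subst l; rewrite (bigD1 t) //= [X in _ + X]big1 ?addr0 => [|t' t't]; last first.
  have tt : fusion_index i j t <> fusion_index i j t'.
    by move=> E; case/eqP: t't; apply: val_inj; move: E; rewrite /fusion_index /=; lia.
  rewrite mulr_sumr raddf_sum big1 // => s _ /=.
  rewrite mulr_sumr raddf_sum big1 // => s' _ /=.
  by rewrite -scalerAr linearZ /= h_orth_neq ?mulr0.
rewrite mulr_sumr raddf_sum (bigD1 a) //= [X in _ + X]big1 ?addr0 => [|s /negbTE sa].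
  rewrite mulr_sumr raddf_sum (bigD1 p) //= [X in _ + X]big1 ?addr0 => [|s' /negbTE sp].
    by rewrite -scalerAr linearZ /= h_orth !eqxx !mul1r.
  by rewrite -scalerAr linearZ /= h_orth [p == s']eq_sym sp mulr0 mul0r mulr0.
rewrite mulr_sumr raddf_sum big1 // => s' _ /=.
by rewrite -scalerAr linearZ /= h_orth [a == s]eq_sym sa !mul0r mulr0.
Qed.

Lemma haar_triple i j l (Z : 'M[C]_(d l)) (X : 'M[C]_(d i)) (Y : 'M[C]_(d j)) :
  h (star (coef_elt Z) * (coef_elt X * coef_elt Y)) =
  tau (V i j (l := l)) Z X^T Y / (d l)%:R.
Proof.
pose W := coef_elt X * coef_elt Y; rewrite -/W.
rewrite /tau star_sum !mulr_suml raddf_sum; apply: eq_bigr => a _ /=.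
rewrite star_sum !mulr_suml raddf_sum; apply: eq_bigr => p _ /=.
rewrite starZ -scalerAl linearZ /= -mulrA; congr (_ * _).
rewrite /mxtrace mulr_suml /W /coef_elt.
transitivity (\sum_b \sum_q \sum_c \sum_r
  (X b q * Y c r) * (V i j a b c * (V i j p q r)^*%R / (d l)%:R)).
  rewrite mulr_suml mulr_sumr raddf_sum; apply: eq_bigr => b _ /=.
  rewrite mulr_suml mulr_sumr raddf_sum; apply: eq_bigr => q _ /=.
  rewrite !mulr_sumr raddf_sum; apply: eq_bigr => c _ /=.
  rewrite !mulr_sumr raddf_sum; apply: eq_bigr => r _ /=.
  by rewrite -scalerAl -!scalerAr scalerA linearZ /= haar_triple_coef.
rewrite exchange_big /=.
under eq_bigr do under eq_bigr do rewrite exchange_big /=.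
under eq_bigr do rewrite exchange_big /=.
rewrite exchange_big; apply: eq_bigr => r _ /=.
rewrite mxE mulr_suml.
transitivity (\sum_c \sum_q \sum_b
  (X b q * Y c r) * (V i j a b c * (V i j p q r)^*%R / (d l)%:R)).
  rewrite [RHS]exchange_big; apply: eq_bigr => q _ /=.
  by rewrite exchange_big.
apply: eq_bigr => c _; rewrite mxE !mulr_suml.
under [RHS]eq_bigr do rewrite mxE !mulr_suml.
rewrite [RHS]exchange_big; apply: eq_bigr => q _ /=.
by apply: eq_bigr => b _; rewrite adjC_mxE [X^T _ _]mxE; ring.
Qed.

Lemma hs_norm_tr m n (X : 'M[C]_(m, n)) : hs_norm X^T = hs_norm X.
Proof.
rewrite /hs_norm !hs_sqrE exchange_big; congr (Num.sqrt (complex.Re _)).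
by apply: eq_bigr => i _; apply: eq_bigr => j _; rewrite mxE.
Qed.

Lemma haar_triple_neq0 i j l (Z : 'M[C]_(d l)) (X : 'M[C]_(d i)) (Y : 'M[C]_(d j)) :
  ~~ fusion_ok i j l -> h (star (coef_elt Z) * (coef_elt X * coef_elt Y)) = 0.
Proof.
move=> nok; rewrite haar_triple /tau big1 ?mul0r // => a _; rewrite big1 // => p _.
by rewrite (V_eq0 a nok) mulmx0 mul0mx raddf0 mulr0.
Qed.

(** The norm of [coef_elt X] in [L_2], by [haar_coef_sqr] and [d_bracket]. *)
Definition coef_norm k (X : 'M[C]_(d k)) : R := hs_norm X / Num.sqrt [k.+1]q.

Lemma haar_triple_le a b c (Z : 'M[C]_(d (b + c))) (X : 'M[C]_(d (a + b)))
    (Y : 'M[C]_(d (a + c))) :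
  `|h (star (coef_elt Z) * (coef_elt X * coef_elt Y))| <=
  (Num.sqrt (weight2 N%:R a b * weight2 N%:R a c * weight2 N%:R b c) *
    coef_norm X * coef_norm Y * coef_norm Z)%:C.
Proof.
have D0 k : 0 < [k.+1]q by exact: bracket_gt0.
have sD0 k : 0 < Num.sqrt [k.+1]q by rewrite sqrtr_gt0.
have mu0 : 0 < mu N%:R a b c :> R by exact: mu_gt0.
rewrite haar_triple normrM normfV normr_nat d_bracketC.
rewrite ler_pdivrMr ?ltcR // -rmorphM; apply: le_trans (V_tau _ _ _) _.
rewrite hs_norm_tr lecR.
have hsE k (M : 'M[C]_(d k)) : hs_norm M = coef_norm M * Num.sqrt [k.+1]q.
  by rewrite /coef_norm mulfVK // gt_eqF.
have cn0 k (M : 'M[C]_(d k)) : 0 <= coef_norm M.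
  by rewrite divr_ge0 ?hs_norm_ge0 // ltW.
set Kst := Num.sqrt (_ * _).
(* The square roots convert Hilbert-Schmidt norms into [L_2] norms. The one for [b + c] ends up in
   the denominator because [haar_triple] divides by the full dimension. *)
have le_K : Num.sqrt [(a + b).+1]q * Num.sqrt [(a + c).+1]q /
    Num.sqrt [(b + c).+1]q / mu N%:R a b c <= Kst.
  set L := (X in X <= _).
  have L0 : 0 <= L by rewrite !divr_ge0 ?mulr_ge0 // ltW.
  rewrite -(ger0_norm L0) -sqrtr_sqr.
  rewrite /Kst ler_sqrt; last by rewrite (mulr_ge0 (mulr_ge0 _ _)) // weight2_ge0.
  rewrite /L !exprMn !exprVn !sqr_sqrtr ?(ltW (D0 _)) //.
  exact: (fusion_constant_le x3).
have := ler_wpM2r (mulr_ge0 (mulr_ge0 (cn0 _ X) (cn0 _ Y)) (cn0 _ Z)) le_K.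
move=> /(ler_wpM2r (ltW (D0 (b + c)%N))); apply: etrans; congr (_ <= _).
  have alg (p q r sp sq sr m D : R) : sr != 0 -> m != 0 -> sr ^+ 2 = D ->
      r * sr * (p * sp) * (q * sq) / m = sp * sq / sr / m * (p * q * r) * D.
    by move=> sr0 m0 <-; field; rewrite ?sr0 ?m0.
  by rewrite !hsE; apply: alg; rewrite ?gt_eqF // sqr_sqrtr ?(ltW (D0 _)).
by rewrite !mulrA.
Qed.

Lemma haar_cube_le n (c : forall k, 'M[C]_(d k)) (S Q : R) : 0 <= Q -> c 0%N = 0 ->
  \sum_(k < n.+1) coef_norm (c k) ^+ 2 = S ^+ 2 ->
  \sum_(k < n.+1) (alpha R N k - 1) * coef_norm (c k) ^+ 2 = Q ^+ 2 ->
  forall u, u = \sum_(k < n.+1) coef_elt (c k) ->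
  `|h (star u * (u * u))| <= (3 * S ^+ 2 * Q + Q ^+ 3)%:C.
Proof.
move=> Q0 c0 hS hQ u uE.
pose H i j l := h (star (coef_elt (c l)) * (coef_elt (c i) * coef_elt (c j))).
have hE : h (star u * (u * u)) =
    \sum_(i < n.+1) \sum_(j < n.+1) \sum_(l < n.+1) H i j l.
  rewrite {2}uE mulr_suml mulr_sumr raddf_sum; apply: eq_bigr => i _ /=.
  rewrite {2}uE !mulr_sumr raddf_sum; apply: eq_bigr => j _ /=.
  by rewrite uE star_sum mulr_suml raddf_sum.
apply: (@le_trans _ _
    (\sum_(i < n.+1) \sum_(j < n.+1) \sum_(l < n.+1) complex.Re `|H i j l|)%:C).
  rewrite hE; do 2!(apply: norm_sum_le => ?).
  by apply: norm_sum_le => l; rewrite -norm_Re.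
rewrite lecR.
apply: (hankel_sum_le N3 (y := fun k => coef_norm (c k))
  (T := fun i j l => complex.Re `|H i j l|)) => //.
- by move=> k; rewrite divr_ge0 ?hs_norm_ge0 ?sqrtr_ge0.
- rewrite /coef_norm c0 /hs_norm hs_sqrE big1 ?sqrtr0 ?mul0r // => i _.
  by rewrite big1 // => j _; rewrite mxE normr0 expr0n.
- by move=> a b c'; rewrite -lecR -norm_Re; exact: haar_triple_le.
- move=> i j l nabc; rewrite /H haar_triple_neq0 ?normr0 //.
  by apply/fusion_okP => -[a [b [c' [Ei Ej El]]]]; exact: (nabc a b c').
Qed.

End Category.

(** * What the defining relations and the fusion rules provide *)

Section QuantumGroupData.
Variables (R : realType) (A T : cstarAlg R).
Notation C := R[i].

Lemma conj_mx_scalM m n p (M : 'M[C]_(m, n)) (v : 'M[A]_(n, p)) :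
  conj_mx (scal_mx A M *m v) = scal_mx A (conjC_mx M) *m conj_mx v.
Proof.
apply/matrixP => i j; rewrite mxE !scal_mulmxE star_sum.
by apply: eq_bigr => k _; rewrite starZ !mxE.
Qed.

Lemma conj_mx_mul_scal m n p (v : 'M[A]_(m, n)) (M : 'M[C]_(n, p)) :
  conj_mx (v *m scal_mx A M) = conj_mx v *m scal_mx A (conjC_mx M).
Proof.
apply/matrixP => i j; rewrite mxE !mul_scal_mxE star_sum.
by apply: eq_bigr => k _; rewrite starZ !mxE.
Qed.

Lemma rep_equiv_one n (v : 'M[A]_n) : rep_equiv v (1%:M : 'M_1) -> v = 1%:M.
Proof.
case=> S [SS' _ vS].
by rewrite -[v]mulmx1 -(scal_mx1 A) -SS' scal_mxM mulmxA vS mulmx1.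
Qed.

(* A representation equivalent to [u1] inherits the relation
   [u1 = F u1-bar F^-1], for a matrix with the same properties as [F]. *)
Lemma conjugate_intertwiner N (F : 'M[C]_N) (eps : C) (u1 : 'M[A]_N) n (v : 'M[A]_n) :
  adjC_mx F *m F = 1%:M -> F *m conjC_mx F = eps%:M ->
  u1 = scal_mx A F *m conj_mx u1 *m scal_mx A (invmx F) -> rep_equiv v u1 ->
  exists Rm : 'M[C]_n, [/\ Rm *m adjC_mx Rm = 1%:M, adjC_mx Rm *m Rm = 1%:M,
    Rm *m conjC_mx Rm = eps%:M &
    v *m scal_mx A Rm = scal_mx A Rm *m conj_mx v].
Proof.
move=> F'F FF u1E [S [SS' S'S vS]].
have FF' : F *m adjC_mx F = 1%:M by exact: mulmx1C.
have FV : invmx F = adjC_mx F.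
  by rewrite -[invmx F]mul1mx -F'F mulmxK // (mulmx1_unit FF').1.
have TS : S^T *m conjC_mx S = 1%:M.
  have := congr1 (@conjC_mx R _ _) S'S; rewrite conjC_mxM conjC_mx_scalar rmorph1.
  by rewrite -adjC_mx_conj adjC_conj_mx.
have ST : conjC_mx S *m S^T = 1%:M.
  have := congr1 (@conjC_mx R _ _) SS'; rewrite conjC_mxM conjC_mx_scalar rmorph1.
  by rewrite -adjC_mx_conj adjC_conj_mx.
have TE : adjC_mx S^T = conjC_mx S by apply/matrixP => i j; rewrite !mxE.
have CT : conjC_mx S^T = adjC_mx S by apply/matrixP => i j; rewrite !mxE.
exists (S *m F *m S^T); split.
- rewrite !adjC_mulmx TE -!mulmxA (mulmxA S^T) TS mul1mx (mulmxA F) FF' mul1mx.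
  by [].
- rewrite !adjC_mulmx TE !mulmxA -(mulmxA _ (adjC_mx S)) S'S mulmx1.
  by rewrite -(mulmxA _ (adjC_mx F)) F'F mulmx1 ST.
- rewrite !conjC_mxM CT -!mulmxA (mulmxA S^T) TS mul1mx (mulmxA F) FF.
  by rewrite mul_scalar_mx -scalemxAr SS' scale_scalar_mx mulr1.
- have vS' : conj_mx v *m scal_mx A (conjC_mx S) =
      scal_mx A (conjC_mx S) *m conj_mx u1.
    by rewrite -conj_mx_mul_scal vS conj_mx_scalM.
  have uST : conj_mx u1 *m scal_mx A S^T = scal_mx A S^T *m conj_mx v.
    rewrite -[LHS]mul1mx -(scal_mx1 A) -TS scal_mxM -!mulmxA.
    rewrite (mulmxA (scal_mx A (conjC_mx S))) -vS' -!mulmxA -scal_mxM ST.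
    by rewrite scal_mx1 mulmx1.
  rewrite !scal_mxM !mulmxA vS -!mulmxA -uST !mulmxA; congr (_ *m _).
  rewrite -!mulmxA; congr (_ *m _).
  rewrite [in LHS]u1E FV -!mulmxA -scal_mxM F'F scal_mx1 mulmx1.
  by [].
Qed.

(** The intertwining relation conjugates [v] into [conj_mx v] by the unitary [Rm], so [conj_mx v] is
    unitary too. *)
Lemma kac_conjugate n (v : 'M[A]_n) (Rm : 'M[C]_n) : unitary_mx v ->
  Rm *m adjC_mx Rm = 1%:M -> adjC_mx Rm *m Rm = 1%:M ->
  v *m scal_mx A Rm = scal_mx A Rm *m conj_mx v -> kac_mx v.
Proof.
move=> [vv' _] RR' R'R vR a b.
have cE : conj_mx v = scal_mx A (adjC_mx Rm) *m (v *m scal_mx A Rm).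
  by rewrite vR mulmxA -scal_mxM R'R scal_mx1 mul1mx.
have E : conj_mx v *m adj_mx (conj_mx v) = 1%:M.
  rewrite cE !adj_mxM !adj_scal_mx adjC_mxK -!mulmxA (mulmxA (scal_mx A Rm)).
  rewrite -scal_mxM RR' scal_mx1 mul1mx (mulmxA v) vv' mul1mx.
  by rewrite -scal_mxM R'R scal_mx1.
have /matrixP/(_ a b) := E; rewrite !mxE => <-; apply: eq_bigr => k _.
by rewrite adj_mxE !mxE starK.
Qed.

(** In matrix form [v Rm v^T = Rm (conj_mx v) v^T], and [kac_mx] says that the product of the last
    two factors is 1. *)
Lemma invariant_vector n (v : 'M[A]_n) (Rm : 'M[C]_n) : kac_mx v ->
  v *m scal_mx A Rm = scal_mx A Rm *m conj_mx v ->
  forall x y, \sum_z \sum_u Rm z u *: (v x z * v y u) = (Rm x y)%:A.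
Proof.
move=> kv vR x y; rewrite exchange_big /=.
transitivity (\sum_u (scal_mx A Rm *m conj_mx v) x u * v y u).
  apply: eq_bigr => u _; rewrite -vR mul_scal_mxE mulr_suml.
  by apply: eq_bigr => z _; rewrite -scalerAl.
under eq_bigr do rewrite scal_mulmxE mulr_suml.
rewrite exchange_big /=.
transitivity (\sum_z Rm x z *: ((z == y)%:R : A)).
  apply: eq_bigr => z _; rewrite -kv scaler_sumr; apply: eq_bigr => u _.
  by rewrite -scalerAl mxE.
rewrite (bigD1 y) //= eqxx big1 ?addr0 // => z /negbTE ->.
by rewrite scaler0.
Qed.

(** Fusion with [H_1] gives [d_(k+1) N = d_k + d_(k+2)], the recurrence of [bracket]. *)
Lemma irreps_dim (i1 i2 Delta : {lrmorphism A -> T}) N (u1 : 'M[A]_N)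
    (d : nat -> nat) (w : forall k, 'M[A]_(d k)) :
  irreps i1 i2 Delta u1 w ->
  forall k, (d k)%:R = bracket (N%:R : R) k.+1.
Proof.
move=> hw.
have d0 : d 0 = 1%N := rep_equiv_dim (irreps0 hw).
have d1 : d 1 = N := rep_equiv_dim (irreps1 hw).
have dSS k : (d k.+1 * N = d k + d k.+2)%N.
  have := rep_equiv_dim (irreps_fusion hw k.+1 1); rewrite d1 => ->.
  have -> : (minn k.+1 1).+1 = 2%N by lia.
  rewrite big_ord_recl big_ord1 /=.
  by congr (d _ + d _)%N; rewrite ?/bump /=; lia.
have H k : (d k)%:R = bracket (N%:R : R) k.+1 /\
    (d k.+1)%:R = bracket (N%:R : R) k.+2.
  elim: k => [|k [IH0 IH1]].
    by rewrite d0 d1 bracketSS bracket0 bracket1 mulr1 subr0.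
  split=> //; rewrite (bracketSS _ k.+1) -IH0 -IH1 -natrM mulnC dSS natrD.
  by rewrite addrAC subrr add0r.
by move=> k; case: (H k).
Qed.

End QuantumGroupData.

Theorem proposition3p3 (R : realType) (N : nat) (F : 'M[R[i]]_N) (eps : R[i])
  (hN : (3 <= N)%N) (F_GL : F \in unitmx)
  (heps : eps = 1 \/ eps = -1)
  (F_conj : F *m conjC_mx F = eps%:M)
  (F_unitary : adjC_mx F *m F = 1%:M)
  (A T : cstarAlg R) (u1 : 'M[A]_N)
  (i1 i2 Delta : {lrmorphism A -> T})
  (hA : free_orthogonal i1 i2 Delta F u1)
  (h : {scalar A}) (hh : haar_state i1 i2 Delta h)
  (d : nat -> nat) (w : forall k, 'M[A]_(d k))
  (hw : irreps i1 i2 Delta u1 w)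
  (L : A -> A) (hL : generator N w L)
  (u : A) (u_Pol : Pol w u) (u_sa : star u = u) (hu : h u = 0)
  (S Q : R) (S_ge0 : 0 <= S) (Q_ge0 : 0 <= Q)
  (hS : (S ^+ 2)%:C = h (u ^+ 2))
  (hQ : (Q ^+ 2)%:C = h (u * (L u - u))) :
  `|h (u ^+ 3)| <= (3 * S ^+ 2 * Q + Q ^+ 3)%:C.
Proof.
case: hA => [[[_ u1E] _] [tensT _ _] starD _].
have uw k := (irreps_rep hw k).1.
have dE := irreps_dim hw.
have eps_norm : eps * eps^*%R = 1.
  by case: heps => ->; rewrite ?rmorphN ?rmorph1 ?mulrNN mulr1.
have [Rm [RR' R'R Rconj wR]] :=
  conjugate_intertwiner F_unitary F_conj u1E (irreps1 hw).
have w0 : w 0%N = 1%:M := rep_equiv_one (irreps0 hw).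
have kac0 : kac_mx (w 0%N).
  move=> a b; rewrite w0 (bigD1 a) //= big1 => [|k /negbTE ka]; rewrite !mxE.
    by rewrite eqxx star1 mul1r addr0 eq_sym.
  by rewrite eq_sym ka star0 mul0r.
have kac1 : kac_mx (w 1%N) := kac_conjugate (uw 1%N) RR' R'R wR.
pose fb i j := boolp.cid (fusion_blocks (irreps_fusion hw i j)).
pose U i j := sval (fb i j).
have U_hom i j t : is_hom w (@U i j t) by case: (svalP (fb i j)).
have U_cohom i j t : is_cohom w (@U i j t) by case: (svalP (fb i j)).
have U_on i j t : orthonormal_fam (@U i j t) by case: (svalP (fb i j)).
have U_compl i j p q p' q' : \sum_t \sum_s @U i j t s p q * (@U i j t s p' q')^*%R =
    (p == p')%:R * (q == q')%:R by case: (svalP (fb i j)).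
have kac k : kac_mx (w k) := kac_all U_cohom U_on kac0 kac1.
have inj l e : l <> e -> ~ rep_equiv (w l) (w e).
  by move=> le /(irreps_inj hw).
have schur_neq l e (P : 'M_(d l, d e)) : l <> e ->
    w l *m scal_mx A P = scal_mx A P *m w e -> P = 0.
  move=> le wP; apply/eqP/negPn/negP => P0; apply: (inj l e le).
  exact: schur_equiv (uw l) (uw e) (irreps_irr hw l) (irreps_irr hw e) wP P0.
have schur_eq l (P : 'M_(d l)) : w l *m scal_mx A P = scal_mx A P *m w l ->
    exists c, P = c%:M := schur_scalar (irreps_irr hw l).
have orth_neq l e a p s t : l <> e -> h (star (w l a p) * w e s t) = 0.
  move=> le; exact: (haar_orth_neq tensT starD hh _ _ _ _ (irreps_rep hw l)
    (irreps_rep hw e) (irreps_irr hw l) (irreps_irr hw e) (inj l e le)).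
have orth l a p s t : h (star (w l a p) * w l s t) =
    (a == s)%:R * (p == t)%:R / (d l)%:R.
  exact: (haar_orth tensT starD hh _ _ _ _ (irreps_rep hw l) (irreps_irr hw l)
    (kac l)).
case: u_Pol => n [y [y_coef uE]].
pose c k : 'M_(d k) := if (k < n)%N then sval (boolp.cid (y_coef k)) else 0.
have cE k : (k < n)%N -> y k = coef_elt w (c k).
  by rewrite /c => ->; rewrite [LHS](svalP (boolp.cid (y_coef k))).
have elt0 k : coef_elt w (0 : 'M_(d k)) = 0.
  by rewrite /coef_elt big1 // => i _; rewrite big1 // => j _; rewrite mxE scale0r.
(* The added degree [n] has [c n = 0]; it ensures that degree 0 occurs in the sum even when
   [n = 0]. *)
have uS : u = \sum_(k < n.+1) coef_elt w (c k).
  rewrite uE big_ord_recr /= {2}/c ltnn elt0 addr0.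
  by apply: eq_bigr => k _; rewrite cE.
have LuE : L u = \sum_(k < n.+1) (alpha R N k)%:C *: coef_elt w (c k).
  by rewrite uS (hL n.+1 (fun k => coef_elt w (c k))) // => k; exists (c k).
(* Weights [1] give [S ^+ 2], and weights [alpha k - 1] give [Q ^+ 2]. *)
have sqr_sum (r : nat -> R) :
    h (u * \sum_(k < n.+1) (r k)%:C *: coef_elt w (c k)) =
    (\sum_(k < n.+1) r k * coef_norm N (c k) ^+ 2)%:C.
  rewrite -{1}u_sa {1}uS star_sum mulr_suml raddf_sum sum_real_complex.
  apply: eq_bigr => k _ /=.
  rewrite mulr_sumr raddf_sum (bigD1 k) //= big1 ?addr0 => [|l lk]; last first.
    rewrite -scalerAr linearZ /= (haar_coef_neq orth_neq) ?mulr0 //.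
    by move=> E; case/eqP: lk; apply: val_inj.
  rewrite -scalerAr linearZ /= (haar_coef_sqr orth) -rmorphM; congr (_ * _)%:C.
  have b0 : 0 <= bracket N%:R k.+1 :> R by apply: bracket_ge0; rewrite ler_nat.
  by rewrite /coef_norm expr_div_n (sqr_sqrtr b0) dE.
(* Since [w 0] is trivial of dimension 1, the component of degree 0 is a multiple of 1. The other
   degrees are orthogonal to 1, so that multiple is [h u]. *)
have c0 : c 0%N = 0.
  have d0 : d 0 = 1%N := rep_equiv_dim (irreps0 hw).
  pose a0 : 'I_(d 0%N) := cast_ord (esym d0) ord0.
  have all_a (i : 'I_(d 0%N)) : i = a0.
    by apply: val_inj; have := ltn_ord i; rewrite /=; move: (nat_of_ord i); rewrite d0; case.
  have sum0 (G : 'I_(d 0%N) -> A) : \sum_k G k = G a0.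
    by rewrite (bigD1 a0) //= big1 ?addr0 // => k; rewrite (all_a k) eqxx.
  have elt00 (X : 'M_(d 0%N)) : coef_elt w X = X a0 a0 *: 1.
    by rewrite /coef_elt !sum0 w0 mxE eqxx.
  apply/matrixP => i j; rewrite mxE (all_a i) (all_a j).
  have := hu; rewrite uS raddf_sum (bigD1 ord0) //= big1 ?addr0 => [|l l0].
    by rewrite elt00 linearZ /=; case: hh => -> _ _ _; rewrite mulr1.
  have one_elt : coef_elt w (1%:M : 'M_(d 0%N)) = 1.
    by rewrite elt00 mxE eqxx scale1r.
  rewrite -[coef_elt w _]mul1r -star1 -one_elt (haar_coef_neq orth_neq) //.
  by move=> E; case/eqP: l0; apply: val_inj.
rewrite exprS expr2 -{1}u_sa.
apply: (haar_cube_le U_hom U_cohom U_on U_compl schur_neq schur_eq hN dE RR' R'R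
  Rconj eps_norm (invariant_vector kac1 wR) orth_neq orth Q_ge0 c0 _ _ uS).
- apply: (@complexI R); rewrite hS expr2.
  have := sqr_sum (fun=> 1).
  under eq_bigr do rewrite scale1r.
  by rewrite -uS => ->; congr (_%:C); apply: eq_bigr => k _; rewrite mul1r.
- apply: (@complexI R); rewrite hQ -(sqr_sum (fun k => alpha R N k - 1)) LuE.
  rewrite {3}uS -sumrB.
  congr (h (_ * _)); apply: eq_bigr => k _.
  by rewrite rmorphB rmorph1 scalerBl scale1r.
Qed.
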